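(* Let $M$ be a compact connected Riemann surface and let $p\in M$. Let $N$ be a compact connected Riemann surface, let $U\subset N$ be an open subset, and suppose that $\phi: M\setminus\{p\}\to U$ is an isomorphism of Riemann surfaces (a biholomorphism). Then $\phi$ extends to an isomorphism of Riemann surfaces $M\to N$; that is, there is a biholomorphism $\Phi:M\to N$ with $\Phi|_{M\setminus\{p\}}=\phi$.
   Context: A Riemann surface is a one-dimensional complex manifold (without boundary). Open subsets of Riemann surfaces carry the induced complex structure. Nothing is assumed about the boundary $\partial U$ of $U$ in $N$. *)

(* Defs.v *)
From mathcomp Require Import all_boot all_order all_algebra.
From mathcomp Require Import complex.
From mathcomp Require Import all_classical all_reals all_analysis.

Set Implicit Arguments.
Unset Strict Implicit.
Unset Printing Implicit Defensive.

Import Order.TTheory GRing.Theory Num.Theory.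
Import numFieldNormedType.Exports.

Local Open Scope classical_set_scope.
Local Open Scope ring_scope.

(* The alias [^o] carries the canonical topology and norm of the field R[i];
   [derivable _ a 1] over it is complex differentiability at [a]. *)
Notation Cplane R := (R[i]^o).

Definition holomorphic_on (R : realType) (A : set (Cplane R))
    (g : Cplane R -> Cplane R) : Prop :=
  forall a, A a -> derivable g a 1.

(* A chart is a function on all of T, of which only the values on [chart_dom]
   are meaningful. *)
Record chart (R : realType) (T : topologicalType) := Chart {
  chart_dom : set T ;
  chart_map :> T -> Cplane R }.

(* A homeomorphism from an open subset of T onto an open subset of C, that is,
   an injective, continuous and open map on an open domain. *)
Definition is_chart (R : realType) (T : topologicalType) (c : chart R T) : Prop :=
  [/\ open (chart_dom c),
      {in chart_dom c &, injective c},
      {within chart_dom c, continuous c} &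
      forall V : set T, open V -> V `<=` chart_dom c -> open (c @` V)].

(* [h] restricted to D is holomorphic when read in the coordinate [z], which is
   injective on D: the function h \o z^-1 : z(D) -> C, here named g, is
   holomorphic. *)
Definition holomorphic_in (R : realType) (T : Type) (D : set T)
    (z h : T -> Cplane R) : Prop :=
  exists g : Cplane R -> Cplane R,
    holomorphic_on (z @` D) g /\ (forall x, D x -> g (z x) = h x).

(* The atlas is not required to be maximal: holomorphic maps depend only on the
   maximal atlas that it generates. *)
Record riemannSurface (R : realType) := RiemannSurface {
  rs_space :> topologicalType ;
  rs_hausdorff : hausdorff_space rs_space ;
  rs_second_countable : @second_countable rs_space ;
  atlas : set (chart R rs_space) ;
  atlas_chart : forall c, atlas c -> is_chart c ;
  atlas_cover : forall x : rs_space, exists2 c, atlas c & chart_dom c x ;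
  atlas_compat : forall c d, atlas c -> atlas d ->
    holomorphic_in (chart_dom c `&` chart_dom d) c d }.

Arguments atlas {R} _ _.

Section OpenSurface.
Context {R : realType} (M : riemannSurface R) (A : set M).

Definition chart_restr (c : chart R M) : chart R A :=
  Chart ((set_val : A -> M) @^-1` chart_dom c) (c \o set_val).

Definition atlas_restr : set (chart R A) := chart_restr @` atlas M.

Lemma set_type_hausdorff : hausdorff_space A.
Proof.
rewrite open_hausdorff => x y xy.
have vxy : (set_val x : M) != set_val y.
  by apply: contra_neq xy => /val_inj.
have := @rs_hausdorff R M.
rewrite open_hausdorff => /(_ _ _ vxy) [[B C] /= [Bx Cy] [oB oC /eqP BC]].
exists ((set_val : A -> M) @^-1` B, (set_val : A -> M) @^-1` C) => /=.
  by split; rewrite inE /=; [move: Bx | move: Cy]; rewrite inE.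
split; [by exists B | by exists C |].
by rewrite -preimage_setI BC preimage_set0.
Qed.

Lemma set_type_second_countable : @second_countable A.
Proof.
have [B cB [oB bB]] := @rs_second_countable R M.
exists ((fun W => (set_val : A -> M) @^-1` W) @` B).
  exact: (card_le_trans (card_image_le _ _)).
split=> [_ [W BW <-]|x V [_ [[W oW <-] Wx WV]]].
  by exists W => //; exact: oB.
have /bB [W' [BW' W'x] W'W] : nbhs (set_val x : M) W by exact: open_nbhs_nbhs.
exists ((set_val : A -> M) @^-1` W'); first by split=> //; exists W'.
by move=> y /W'W; exact: WV.
Qed.

Hypothesis oA : open A.

Lemma chart_restr_is_chart c : atlas_restr c -> is_chart c.
Proof.
move=> [d /atlas_chart [oD injD ctD opD] <-]; split => /=.
- by exists (chart_dom d).
- move=> x y; rewrite !inE /= => Dx Dy dxy; apply: val_inj.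
  by apply: injD => //; rewrite inE.
- have cd : {in chart_dom d, continuous d}.
    by rewrite -continuous_open_subspace.
  rewrite continuous_open_subspace; last by exists (chart_dom d).
  move=> x; rewrite inE /= => Dx.
  apply: (@continuous_comp A M _ set_val d); first exact: initial_continuous.
  by apply: cd; rewrite inE.
- move=> V [W oW <-] VD.
  have -> : (d \o set_val) @` ((set_val : A -> M) @^-1` W) = d @` (W `&` A).
    rewrite eqEsubset; split=> [_ [x Wx <-]|_ [x [Wx Ax] <-]].
      by exists (set_val x) => //; split=> //; exact: set_valP.
    by exists (exist _ x (mem_set Ax)).
  apply: opD; first exact: openI.
  by move=> x [Wx Ax]; exact: (VD (exist _ x (mem_set Ax)) Wx).
Qed.

Lemma atlas_restr_cover (x : A) : exists2 c, atlas_restr c & chart_dom c x.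
Proof.
have [c Mc cx] := atlas_cover (set_val x : M).
by exists (chart_restr c) => //; exists c.
Qed.

Lemma atlas_restr_compat c d : atlas_restr c -> atlas_restr d ->
  holomorphic_in (chart_dom c `&` chart_dom d) c d.
Proof.
move=> [c' Mc <-] [d' Md <-]; have [g [hg gE]] := atlas_compat Mc Md.
exists g; split=> [_ [x Dx <-]|x Dx]; last exact: gE.
by apply: hg; exists (set_val x).
Qed.

(* The complex structure induced on the open subset A. *)
Definition open_surface : riemannSurface R :=
  RiemannSurface set_type_hausdorff set_type_second_countable
    chart_restr_is_chart atlas_restr_cover atlas_restr_compat.

End OpenSurface.

Lemma open_setC1 (R : realType) (M : riemannSurface R) (p : M) :
  open (~` [set p]).
Proof.
apply/closed_openC/accessible_closed_set1/hausdorff_accessible.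
exact: rs_hausdorff.
Qed.

Definition punctured (R : realType) (M : riemannSurface R) (p : M) :
    riemannSurface R :=
  open_surface (open_setC1 p).

Definition holomorphic (R : realType) (M N : riemannSurface R) (f : M -> N) :
    Prop :=
  continuous f /\
  forall c d, atlas M c -> atlas N d ->
    holomorphic_in (chart_dom c `&` f @^-1` chart_dom d) c (d \o f).

Definition biholomorphism (R : realType) (M N : riemannSurface R)
    (f : M -> N) : Prop :=
  holomorphic f /\
  exists g : N -> M, [/\ holomorphic g, cancel f g & cancel g f].

(* Main.v *)
Require Import Defs.
From mathcomp Require Import all_boot all_order all_algebra.
From mathcomp Require Import finmap complex ring lra.
From mathcomp Require Import all_classical all_reals all_analysis.

(** Let z be a coordinate of M at p with z(p) = 0. The theorem says that the
    isolated singularity of the injective map phi at p is removable. The proof has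
    three steps.

    Some circles around p have small images. In the coordinate log z the map phi
    becomes a map G on a left half-plane, under which discs with disjoint real parts
    have disjoint images. If G maps a sequence of such discs into coordinate discs
    of N, then the images of the concentric discs of a quarter of the radius shrink:
    otherwise, after rescaling to the unit disc, the derivatives would be bounded
    below at some points, and infinitely many of the disjoint images would contain
    discs of a fixed radius (disc_in_image, two_points). As N has a finite cover by
    coordinate discs, this shows that G is uniformly small on discs of a fixed radius far to the left: at
    a point where this fails one zooms in until the failure occurs at a scale r
    but no longer at the scale r / 2, and then the discs of radius r / 2 shrink,
    which is a contradiction (point_picking, eventually_small). So the image of a
    vertical segment of length 2 pi shrinks as well: the images of suitable circles
    converge to a point q of N (small_circles).

    The singularity is isolated in N. A circle around p whose image lies in a small
    disc B around q cuts M into a punctured disc and an exterior. The connectedness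
    of N forces the image of the exterior to contain everything outside of B
    (complement_exterior). Letting B shrink, phi(x) tends to q as x tends to p, and
    q is the only point of N that is not in U (puncture_limit).

    So phi extends to a continuous bijection from M to N, the inverse of which is
    continuous as M is compact. Both maps are holomorphic off one point, hence
    everywhere, by Riemann's theorem for a function that is continuous at the
    exceptional point (removable_singularity).

    The function theory rests on Goursat's theorem for rectangles (goursat).
    Applied to F o exp it says that the mean of F over the circles around 0 does
    not depend on the radius (circle_int_annulus). Cauchy's formula follows, for
    functions on a disc that are continuous at the center and holomorphic elsewhere
    (cauchy_formula); its second order remainder term gives the removable
    singularity theorem and a quantitative form of the open mapping theorem. *)

Set Implicit Arguments.
Unset Strict Implicit.
Unset Printing Implicit Defensive.

Import Order.TTheory GRing.Theory Num.Theory.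
Import numFieldNormedType.Exports.

Local Open Scope classical_set_scope.
Local Open Scope ring_scope.

Local Notation Re := complex.Re.
Local Notation Im := complex.Im.

(** * The complex plane *)

Section ComplexPlane.
Context {R : realType}.
Implicit Types (z w a : Cplane R) (e x y : R).
Local Open Scope complex_scope.

(** The norm of R[i] takes its values in R[i]; estimates are carried out with its
    real part. *)
Definition cmod z : R := Normc.normc z.

Arguments cmod : simpl never.

Lemma normrE z : `|z| = (cmod z)%:C. Proof. by []. Qed.

Lemma cmodR x : cmod x%:C = `|x|.
Proof. by rewrite /cmod /= expr0n /= addr0 sqrtr_sqr. Qed.

Lemma cmodM z w : cmod (z * w) = cmod z * cmod w.
Proof. exact: Normc.normcM. Qed.

Lemma cmodV z : cmod z^-1 = (cmod z)^-1.
Proof. exact: Normc.normcV. Qed.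

Lemma cmod_div z w : cmod (z / w) = cmod z / cmod w.
Proof. by rewrite cmodM cmodV. Qed.

Lemma cmod0 : cmod 0 = 0.
Proof. exact: Normc.normc0. Qed.

Lemma cmod1 : cmod 1 = 1.
Proof. exact: Normc.normc1. Qed.

Lemma cmodi : cmod 'i = 1.
Proof. by rewrite /cmod /= expr0n /= add0r expr1n sqrtr1. Qed.

Lemma cmodX z n : cmod (z ^+ n) = cmod z ^+ n.
Proof. by elim: n => [|n IH]; rewrite ?expr0 ?cmod1 // !exprS cmodM IH. Qed.

Lemma cmod_ge0 z : 0 <= cmod z.
Proof. by case: z => p q; exact: sqrtr_ge0. Qed.

Lemma cmodN z : cmod (- z) = cmod z.
Proof. by apply: complexI; rewrite -!normrE normrN. Qed.

Lemma cmodC z w : cmod (z - w) = cmod (w - z).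
Proof. by rewrite -cmodN opprB. Qed.

Lemma cmodD z w : cmod (z + w) <= cmod z + cmod w.
Proof. by rewrite -lecR rmorphD /= -!normrE ler_normD. Qed.

Lemma cmodB z w : cmod (z - w) <= cmod z + cmod w.
Proof. by rewrite -(cmodN w) cmodD. Qed.

Lemma cmod_dist z w a : cmod (z - w) <= cmod (z - a) + cmod (a - w).
Proof. by rewrite -(subrKA a z) cmodD. Qed.

Lemma cmod_subl z w : cmod z - cmod w <= cmod (z - w).
Proof. by rewrite lerBlDr; apply: le_trans (cmodD _ _); rewrite subrK. Qed.

Lemma cmod_eq0 z : (cmod z == 0) = (z == 0).
Proof. by apply/eqP/eqP => [/Normc.eq0_normc|->]; rewrite ?cmod0. Qed.

Lemma cmod_gt0 z : (0 < cmod z) = (z != 0).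
Proof. by rewrite lt_neqAle cmod_ge0 andbT eq_sym cmod_eq0. Qed.

Lemma Re_le_cmod z : `|Re z| <= cmod z.
Proof.
case: z => p q; rewrite /cmod /= -sqrtr_sqr ler_wsqrtr //.
by rewrite lerDl sqr_ge0.
Qed.

Lemma Im_le_cmod z : `|Im z| <= cmod z.
Proof.
case: z => p q; rewrite /cmod /= -sqrtr_sqr ler_wsqrtr //.
by rewrite lerDr sqr_ge0.
Qed.

Lemma cmod_le_ReIm z : cmod z <= `|Re z| + `|Im z|.
Proof.
rewrite [z in cmod z]complexE (le_trans (cmodD _ _)) //.
by rewrite cmodM cmodi mul1r !cmodR.
Qed.

Lemma nbhsCP a (A : set (Cplane R)) :
  nbhs a A <-> exists2 e, 0 < e & forall z, cmod (z - a) < e -> A z.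
Proof.
split=> [/(nbhs_normP a A)[[e e'] /=]|[e e0 eA]].
  rewrite ltcE /= => /andP[/eqP -> e0] eA; exists e => // z za.
  by apply: eA; rewrite /ball_ /= distrC normrE ltcR.
apply/(nbhs_normP a A); exists e%:C => /=; first by rewrite ltcR.
by move=> z; rewrite /ball_ /= distrC normrE ltcR; exact: eA.
Qed.

#[global] Instance nbhsC_filter a : ProperFilter (nbhs a).
Proof. exact: (@nbhs_pfilter (Cplane R) a). Qed.

Lemma near_ballC a e : 0 < e -> \forall z \near a, cmod (z - a) < e.
Proof. by move=> e0; apply/nbhsCP; exists e. Qed.

Lemma cvgCP {T : Type} {F : set_system T} {FF : Filter F} (f : T -> Cplane R) a :
  f @ F --> a <-> forall e, 0 < e -> \forall t \near F, cmod (f t - a) < e.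
Proof.
split=> [fa e e0|fa A /nbhsCP[e e0 eA]].
  exact: fa (near_ballC a e0).
by apply: filterS (fa e e0) => t; exact: eA.
Qed.

Lemma continuous_cmodB a : continuous (fun z => cmod (z - a)).
Proof.
move=> z; apply/cvgrPdist_lt => e e0.
apply: filterS (near_ballC z e0) => w wz.
rewrite ltr_norml; have := cmod_dist z a w; have := cmod_dist w a z.
rewrite [cmod (z - w)]cmodC; lra.
Qed.

Lemma continuous_Re : continuous (@Re R : Cplane R -> R).
Proof.
move=> z; apply/cvgrPdist_lt => e e0.
apply: filterS (near_ballC z e0) => w; rewrite cmodC => wz.
by apply: le_lt_trans wz; have := Re_le_cmod (z - w); case: (z); case: (w).
Qed.

Lemma continuous_Im : continuous (@Im R : Cplane R -> R).
Proof.
move=> z; apply/cvgrPdist_lt => e e0.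
apply: filterS (near_ballC z e0) => w; rewrite cmodC => wz.
by apply: le_lt_trans wz; have := Im_le_cmod (z - w); case: (z); case: (w).
Qed.

Lemma cvg_Complex {T : Type} {F : set_system T} {FF : Filter F} (f g : T -> R) x y :
  f @ F --> x -> g @ F --> y ->
  (fun t => f t +i* g t : Cplane R) @ F --> (x +i* y : Cplane R).
Proof.
move=> /cvgrPdist_lt fx /cvgrPdist_lt gy; apply/cvgCP => e e0.
have e20 : 0 < e / 2 by rewrite divr_gt0.
apply: filterS2 (fx _ e20) (gy _ e20) => t; rewrite distrC (distrC y) => ? ?.
by apply: le_lt_trans (cmod_le_ReIm _) _ => /=; lra.
Qed.

(** Heine-Borel: the disc is closed in the square, a product of segments. *)
Lemma compact_disc a e : compact [set z | cmod (z - a) <= e].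
Proof.
pose I (c : R) := `[c - e, c + e]%classic.
pose f (u : R * R) : Cplane R := u.1 +i* u.2.
have cf : continuous f.
  by move=> u; apply: cvg_Complex; [exact: cvg_fst | exact: cvg_snd].
have cK : compact (f @` (I (Re a) `*` I (Im a))).
  apply: continuous_compact; first exact: continuous_subspaceT.
  by apply: compact_setX; exact: segment_compact.
apply: subclosed_compact cK _.
  by apply: (@closed_comp _ _ _ [set y | y <= e]);
    [move=> z _; exact: continuous_cmodB | exact: closed_le].
move=> z /= za; exists (Re z, Im z); last by case: (z).
have := le_trans (Re_le_cmod _) za; have := le_trans (Im_le_cmod _) za.
move: z a {za} => [p q] [p' q'] /=; rewrite /I /= !in_itv /= !ler_norml.
by move=> /andP[? ?] /andP[? ?]; split; apply/andP; split; lra.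
Qed.

End ComplexPlane.

Arguments cmod : simpl never.

(** * Complex differentiability *)

Section Differentiability.
Context {R : realType}.
Implicit Types (f g q : Cplane R -> Cplane R) (a b l z w : Cplane R).
Local Open Scope complex_scope.

Section Limits.
Context {T : Type} {F : set_system T} {FF : Filter F}.
Implicit Types (u v : T -> Cplane R).

Lemma cvgCD u v a b : u @ F --> a -> v @ F --> b ->
  (fun t => u t + v t : Cplane R) @ F --> (a + b : Cplane R).
Proof. exact: (@cvgD _ (Cplane R)). Qed.

Lemma cvgCB u v a b : u @ F --> a -> v @ F --> b ->
  (fun t => u t - v t : Cplane R) @ F --> (a - b : Cplane R).
Proof. exact: (@cvgB _ (Cplane R)). Qed.

Lemma cvgCM u v a b : u @ F --> a -> v @ F --> b ->
  (fun t => u t * v t : Cplane R) @ F --> (a * b : Cplane R).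
Proof. exact: (@cvgM R[i]). Qed.

Lemma cvgCV u a : a != 0 -> u @ F --> a ->
  (fun t => (u t)^-1 : Cplane R) @ F --> (a^-1 : Cplane R).
Proof. exact: (@cvgV R[i]). Qed.

End Limits.

Lemma cvgC_cst b a : (fun _ : Cplane R => b : Cplane R) @ a --> (b : Cplane R).
Proof. exact: cvg_cst. Qed.

Lemma cvgC_sub a b : (fun z => z - a : Cplane R) @ b --> (b - a : Cplane R).
Proof.
apply/cvgCP => e e0; apply: filterS (near_ballC b e0) => z.
by rewrite opprB addrA subrK.
Qed.

(** Caratheodory's form of complex differentiability: q extends the difference
    quotient. It turns the rules of calculus into rules for limits. *)
Definition cdiff f a := exists2 q : Cplane R -> Cplane R, q @ a --> q a &
  forall z, f z = f a + q z * (z - a).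

Lemma cdiffP f a : cdiff f a <-> derivable f a 1.
Proof.
rewrite /derivable; split=> [[q qa fE]|].
  apply/cvg_ex; exists (q a); apply/cvgCP => e e0.
  have /nbhsCP[d d0 dq] : \forall z \near a, cmod (q z - q a) < e.
    by move/cvgCP : qa; exact.
  rewrite near_withinE; apply/nbhsCP; exists d => // h; rewrite subr0 => hd h0.
  have -> : h^-1 *: (f (h *: 1 + a) - f a) = q (h + a).
    rewrite (_ : h *: 1 = h); last by rewrite /GRing.scale /= mulr1.
    rewrite fE [f a + _]addrC !addrK /GRing.scale /=.
    by rewrite [q _ * _]mulrC mulKf.
  by apply: dq; rewrite addrK.
case/cvg_ex => l /cvgCP fl.
exists (fun z => if z == a then l else (f z - f a) / (z - a)); last first.
  move=> z; case: (eqVneq z a) => [->|za]; first by rewrite subrr mulr0 addr0.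
  by rewrite divfK ?subr_eq0 // addrC subrK.
rewrite eqxx; apply/cvgCP => e e0.
have := fl e e0; rewrite near_withinE => /nbhsCP[d d0 dl].
apply/nbhsCP; exists d => // z zd.
case: (eqVneq z a) => [_|za]; first by rewrite subrr cmod0.
have := dl (z - a); rewrite subr0 => /(_ zd); rewrite subr_eq0 => /(_ za).
rewrite (_ : (z - a) *: 1 = z - a); last by rewrite /GRing.scale /= mulr1.
by rewrite /= subrK /GRing.scale /= mulrC.
Qed.

Lemma cdiff_continuous f a : cdiff f a -> f @ a --> f a.
Proof.
move=> [q qa fE]; rewrite [X in X @ _](_ : f = fun z => f a + q z * (z - a)).
  rewrite [X in _ --> X](_ : f a = f a + q a * (a - a)); last first.
    by rewrite subrr mulr0 addr0.
  apply: cvgCD; first exact: cvg_cst.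
  exact: (cvgCM qa (@cvgC_sub a a)).
by apply/funext => z; exact: fE.
Qed.

Lemma cdiff_cst b a : cdiff (fun=> b) a.
Proof.
by exists (fun=> 0) => [|z]; [exact: cvg_cst | rewrite mul0r addr0].
Qed.

Lemma cdiff_id a : cdiff id a.
Proof.
by exists (fun=> 1) => [|z]; [exact: cvg_cst | rewrite mul1r addrC subrK].
Qed.

Lemma cdiffD f g a : cdiff f a -> cdiff g a -> cdiff (fun z => f z + g z) a.
Proof.
move=> [q qa fE] [r ra gE]; exists (fun z => q z + r z); first exact: (cvgCD qa ra).
by move=> z; rewrite fE gE mulrDl addrACA.
Qed.

Lemma cdiffM f g a : cdiff f a -> cdiff g a -> cdiff (fun z => f z * g z) a.
Proof.
move=> [q qa fE] dg; have [r ra gE] := dg.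
exists (fun z => q z * g z + f a * r z).
  apply: (cvgCD (cvgCM qa (cdiff_continuous dg))).
  exact: (cvgCM (cvg_cst _) ra).
by move=> z; rewrite {1}fE [RHS]addrC mulrDl {1}[in LHS]gE; ring.
Qed.

Lemma cdiffN f a : cdiff f a -> cdiff (fun z => - f z) a.
Proof.
move=> /(cdiffM (cdiff_cst (-1) a)).
by congr (cdiff _ a); apply/funext => z; rewrite mulN1r.
Qed.

Lemma cdiffB f g a : cdiff f a -> cdiff g a -> cdiff (fun z => f z - g z) a.
Proof. by move=> df dg; apply: cdiffD => //; exact: cdiffN. Qed.

Lemma cdiff_comp f g a : cdiff f a -> cdiff g (f a) -> cdiff (g \o f) a.
Proof.
move=> df [r ra gE]; have [q qa fE] := df.
exists (fun z => r (f z) * q z) => [|z /=].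
  exact: (cvgCM (cvg_comp _ _ (cdiff_continuous df) ra) qa).
by rewrite gE [in f z - _]fE [f a + _]addrC addrK mulrA.
Qed.

Lemma cdiff_near f g a : {near a, f =1 g} -> cdiff f a -> cdiff g a.
Proof.
move=> fg [q qa fE]; have ga : g a = f a by rewrite (nbhs_singleton fg).
pose r z := if z == a then q a else (g z - g a) / (z - a).
exists r => [|z]; last first.
  rewrite /r; case: eqVneq => [->|za]; first by rewrite subrr mulr0 addr0.
  by rewrite divfK ?subr_eq0 // addrC subrK.
rewrite {2}/r eqxx; apply: cvg_trans qa; apply: near_eq_cvg.
apply: filterS fg => z fgz; rewrite /r; case: eqVneq => [-> //|za].
by rewrite -fgz ga fE [f a + _]addrC addrK mulfK // subr_eq0.
Qed.

Lemma cdiff_inv a : a != 0 -> cdiff (fun z => z^-1) a.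
Proof.
move=> a0; pose q z : Cplane R := if z == 0 then a^-1 ^+ 2 else - (z^-1 * a^-1).
exists q => [|z]; last first.
  rewrite /q; case: eqVneq => [->|z0]; last by field; rewrite a0 z0.
  by rewrite invr0; field.
have near0 : \forall z \near a, z != 0.
  apply/nbhsCP; exists (cmod a); first by rewrite cmod_gt0.
  by move=> z; apply: contraTneq => ->; rewrite sub0r cmodN ltxx.
have qE z : z != 0 -> q z = -1 * (z^-1 * a^-1).
  by rewrite /q => /negbTE ->; rewrite mulN1r.
rewrite (qE a) //; apply: (@cvg_trans _ ((fun z => -1 * (z^-1 * a^-1)) @ a)).
  by apply: near_eq_cvg; apply: filterS near0 => z /qE.
exact: (cvgCM (cvg_cst _) (cvgCM (cvgCV a0 cvg_id) (cvg_cst _))).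
Qed.

Lemma cdiffV f a : f a != 0 -> cdiff f a -> cdiff (fun z => (f z)^-1) a.
Proof. by move=> fa0 df; exact: cdiff_comp df (cdiff_inv fa0). Qed.

Lemma cdiff_div f g a : g a != 0 -> cdiff f a -> cdiff g a ->
  cdiff (fun z => f z / g z) a.
Proof. by move=> ga0 df dg; apply: cdiffM => //; exact: cdiffV. Qed.

Lemma cdiff_affine k b a : cdiff (fun z => b + k * z) a.
Proof.
apply: cdiffD; first exact: cdiff_cst.
by apply: cdiffM; [exact: cdiff_cst | exact: cdiff_id].
Qed.

End Differentiability.

(** * Integrals of complex-valued functions over segments *)

Section ComplexIntegral.
Context {R : realType}.
Implicit Types (f g : R -> Cplane R) (a b c x y : R) (k : Cplane R).
Local Open Scope complex_scope.
Local Notation mu := (@lebesgue_measure R).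

Definition cint a b f : Cplane R :=
  (\int[mu]_(x in `[a, b]) Re (f x)) +i* (\int[mu]_(x in `[a, b]) Im (f x)).

Definition csegment a b f := forall x, a <= x <= b -> f @ x --> f x.

Lemma csegment_integrable a b (u : R -> R) :
  (forall x, a <= x <= b -> u @ x --> u x) ->
  mu.-integrable `[a, b] (EFin \o u).
Proof.
move=> cu; apply: (@continuous_compact_integrable R u); first exact: segment_compact.
by apply: continuous_in_subspaceT => x; rewrite inE /= in_itv /= => /cu.
Qed.

Lemma csegment_Re a b f : csegment a b f ->
  mu.-integrable `[a, b] (EFin \o (fun x => Re (f x))).
Proof.
move=> cf; apply: csegment_integrable => x /cf fx.
exact: (cvg_comp _ _ fx (@continuous_Re _ (f x))).
Qed.

Lemma csegment_Im a b f : csegment a b f ->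
  mu.-integrable `[a, b] (EFin \o (fun x => Im (f x))).
Proof.
move=> cf; apply: csegment_integrable => x /cf fx.
exact: (cvg_comp _ _ fx (@continuous_Im _ (f x))).
Qed.

Lemma csegmentM a b f g : csegment a b f -> csegment a b g ->
  csegment a b (fun x => f x * g x).
Proof. by move=> cf cg x xab; exact: (cvgCM (cf x xab) (cg x xab)). Qed.

Lemma csegmentB a b f g : csegment a b f -> csegment a b g ->
  csegment a b (fun x => f x - g x).
Proof. by move=> cf cg x xab; exact: (cvgCB (cf x xab) (cg x xab)). Qed.

Lemma csegment_cst a b k : csegment a b (fun=> k).
Proof. by move=> x _; exact: cvg_cst. Qed.

Lemma csegment_sub a b c d f :
  a <= c -> d <= b -> csegment a b f -> csegment c d f.
Proof.
move=> ac db cf x /andP[cx xd]; apply: cf; rewrite (le_trans ac cx).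
exact: le_trans db.
Qed.

Lemma eq_cint a b f g : (forall x, a <= x <= b -> f x = g x) ->
  cint a b f = cint a b g.
Proof.
move=> fg; congr (_ +i* _); apply: eq_Rintegral => x; rewrite inE /= in_itv /=;
  by move=> /fg ->.
Qed.

Lemma cintB a b f g : csegment a b f -> csegment a b g ->
  cint a b (fun x => f x - g x) = cint a b f - cint a b g.
Proof.
move=> cf cg; rewrite /cint.
rewrite -[RHS]/((_ - _) +i* (_ - _)) -!RintegralB //;
  try exact: csegment_Re; try exact: csegment_Im.
congr (_ +i* _); apply: eq_Rintegral => x _; by case: (f x); case: (g x).
Qed.

Lemma cintZ a b k f : csegment a b f ->
  cint a b (fun x => k * f x) = k * cint a b f.
Proof.
move=> cf; have If := csegment_Re cf; have Jf := csegment_Im cf.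
case: k => p q; rewrite /cint.
pose I := \int[mu]_(x in `[a, b]) Re (f x).
pose J := \int[mu]_(x in `[a, b]) Im (f x).
have ZI r : mu.-integrable `[a, b] (EFin \o (fun x => r * Re (f x))).
  apply: csegment_integrable => x /cf fx.
  have ct : (fun y => Re (f y)) @ x --> Re (f x).
    exact: (cvg_comp _ _ fx (@continuous_Re _ (f x))).
  by apply: cvgM ct; exact: cvg_cst.
have ZJ r : mu.-integrable `[a, b] (EFin \o (fun x => r * Im (f x))).
  apply: csegment_integrable => x /cf fx.
  have ct : (fun y => Im (f y)) @ x --> Im (f x).
    exact: (cvg_comp _ _ fx (@continuous_Im _ (f x))).
  by apply: cvgM ct; exact: cvg_cst.
rewrite -[RHS]/((p * I - q * J) +i* (p * J + q * I)) -!RintegralZl //.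
rewrite -RintegralB // -RintegralD //.
by congr (_ +i* _); apply: eq_Rintegral => x _; case: (f x).
Qed.

Lemma cint_cst a b k : a <= b -> cint a b (fun=> k) = (b - a)%:C * k.
Proof.
move=> ab; rewrite /cint !Rintegral_cst //=.
rewrite lebesgue_measure_itv /= lte_fin.
case: k => p q /=; move: ab; rewrite le_eqVlt => /predU1P[->|ab].
  by rewrite ltxx /= subrr !mulr0 mul0r.
rewrite ab -EFinD /=.
by rewrite -[RHS]/(_ +i* _) !mul0r subr0 addr0 !(mulrC (b - a)).
Qed.

Lemma cint_cat a b c f : a <= c -> c <= b -> csegment a b f ->
  cint a b f = cint a c f + cint c b f.
Proof.
move=> ac cb cf.
have cat (u : R -> R) : mu.-integrable `[a, b] (EFin \o u) ->
    \int[mu]_(x in `[a, b]) u x =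
    \int[mu]_(x in `[a, c]) u x + \int[mu]_(x in `[c, b]) u x.
  move=> Iu; apply/eqP; rewrite addrC -subr_eq; apply/eqP.
  rewrite Rintegral_itvB ?bnd_simp // Rintegral_itv_obnd_cbnd //.
  apply: integrableS Iu => //; exact: subset_itvr.
rewrite /cint (cat _ (csegment_Re cf)) (cat _ (csegment_Im cf)).
by [].
Qed.

Lemma cint_bound a b f (m : R) : a <= b -> csegment a b f ->
  (forall x, a <= x <= b -> cmod (f x) <= m) ->
  cmod (cint a b f) <= m * (b - a).
Proof.
move=> ab cf fm; set I := cint a b f.
have [I0|I0] := eqVneq (cmod I) 0.
  rewrite I0 mulr_ge0 ?subr_ge0 //; apply: le_trans (fm a _); first exact: cmod_ge0.
  by rewrite lexx.
have I_gt0 : 0 < cmod I by rewrite lt_neqAle eq_sym I0 cmod_ge0.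
(* rotating the integrand by the conjugate of I makes the integral real *)
have cI : csegment a b (fun x => I^*%C * f x).
  exact: (csegmentM (@csegment_cst a b _) cf).
have Isq : cmod I ^+ 2 = \int[mu]_(x in `[a, b]) Re (I^*%C * f x).
  rewrite [RHS](congr1 (@Re R) (cintZ I^*%C cf)) -/I /cmod.
  by case: (I) => p q /=; rewrite sqr_sqrtr ?addr_ge0 ?sqr_ge0 //; ring.
rewrite -(ler_pM2l I_gt0) -expr2 Isq.
have -> : cmod I * (m * (b - a)) = \int[mu]_(x in `[a, b]) (cmod I * m).
  rewrite Rintegral_cst //= lebesgue_measure_itv /= lte_fin.
  move: ab; rewrite le_eqVlt => /predU1P[->|ab].
    by rewrite ltxx /= subrr !mulr0.
  by rewrite ab -EFinD /= mulrA.
apply: le_Rintegral => //; first exact: csegment_Re.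
  by apply: csegment_integrable => x _; exact: cvg_cst.
move=> x; rewrite /= in_itv /= => xab.
apply: le_trans (ler_norm _) _; apply: le_trans (Re_le_cmod _) _.
rewrite cmodM (_ : cmod I^*%C = cmod I) ?ler_wpM2l ?cmod_ge0 ?fm //.
by rewrite /cmod; case: (I) => p q /=; rewrite sqrrN.
Qed.

End ComplexIntegral.

Arguments cint : simpl never.

(** * Goursat's theorem for rectangles *)

Section Goursat.
Context {R : realType}.
Implicit Types (f : Cplane R -> Cplane R) (a b c d w h x y e : R).
Local Open Scope complex_scope.

Lemma nested_halving (u : nat -> R) w : 0 <= w ->
  (forall n, u n <= u n.+1 <= u n + w / 2 ^+ n.+1) ->
  exists x, forall n, u n <= x <= u n + w / 2 ^+ n.
Proof.
move=> w0 uS; pose v n := u n + w / 2 ^+ n.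
have u_le n m : (n <= m)%N -> u n <= u m.
  elim: m => [|m IH]; first by rewrite leqn0 => /eqP ->.
  rewrite leq_eqVlt => /predU1P[-> //|/IH nm]; apply: le_trans nm _.
  by case/andP: (uS m).
have v_le n m : (n <= m)%N -> v m <= v n.
  elim: m => [|m IH]; first by rewrite leqn0 => /eqP ->.
  rewrite leq_eqVlt => /predU1P[-> //|/IH nm]; apply: le_trans nm.
  rewrite /v; have := uS m; rewrite exprS.
  rewrite (_ : w / (2 * 2 ^+ m) = w / 2 ^+ m / 2); first by move=> /andP[]; lra.
  by rewrite invfM mulrA mulrAC.
have uv n m : u n <= v m.
  apply: le_trans (u_le _ _ (leq_maxl n m)) _.
  apply: le_trans (v_le _ _ (leq_maxr n m)).
  by rewrite lerDl divr_ge0 // exprn_ge0.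
exists (sup (range u)) => n; apply/andP; split.
  apply: ub_le_sup; last by exists n.
  by exists (v 0%N) => _ [k _ <-]; exact: uv.
apply: ge_sup; first by exists (u 0%N), 0%N.
by move=> _ [k _ <-]; exact: uv.
Qed.

Lemma halving_lt w e : 0 < e -> exists n, w / 2 ^+ n < e.
Proof.
move=> e0; exists (Num.bound (w / e)).
have := @upper_nthrootP R (w / e) _ (leqnn _).
by rewrite ltr_pdivrMr // ltr_pdivrMr ?exprn_gt0 // mulrC.
Qed.

(** Otherwise successive quarters give nested rectangles without P that shrink to
    a point (x, y), against the hypothesis at (x, y). A rectangle is given by its
    lower left corner and its side lengths. *)
Lemma rectangle_bisection (P : R -> R -> R -> R -> Prop) a c w h :
  0 <= w -> 0 <= h ->
  (forall a c w h, 0 <= w -> 0 <= h ->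
    P a c (w / 2) (h / 2) -> P (a + w / 2) c (w / 2) (h / 2) ->
    P a (c + h / 2) (w / 2) (h / 2) ->
    P (a + w / 2) (c + h / 2) (w / 2) (h / 2) -> P a c w h) ->
  (forall x y, a <= x <= a + w -> c <= y <= c + h -> exists2 e, 0 < e &
    forall a' c' w' h', 0 <= w' -> 0 <= h' -> w' + h' < e ->
      a' <= x <= a' + w' -> c' <= y <= c' + h' -> P a' c' w' h') ->
  P a c w h.
Proof.
move=> w0 h0 quarter small; apply: contrapT => nP.
pose W n := w / 2 ^+ n; pose H n := h / 2 ^+ n.
have WS n : W n.+1 = W n / 2 by rewrite /W exprS invfM mulrA mulrAC.
have HS n : H n.+1 = H n / 2 by rewrite /H exprS invfM mulrA mulrAC.
have W0 n : 0 <= W n by rewrite divr_ge0 // exprn_ge0.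
have H0 n : 0 <= H n by rewrite divr_ge0 // exprn_ge0.
pose bad n (p : R * R) := ~ P p.1 p.2 (W n) (H n).
have step n p : exists q : R * R, bad n p ->
    [/\ bad n.+1 q, p.1 <= q.1 <= p.1 + W n.+1 & p.2 <= q.2 <= p.2 + H n.+1].
  apply: contrapT => noq.
  have all_ok q : p.1 <= q.1 <= p.1 + W n.+1 -> p.2 <= q.2 <= p.2 + H n.+1 ->
      P q.1 q.2 (W n.+1) (H n.+1).
    move=> q1 q2; apply: contrapT => Pq; apply: noq.
    by exists q => bp; split.
  apply: noq; exists p => bp; exfalso; apply: bp.
  have := W0 n; have := H0 n => Hn Wn.
  have in0 (s t : R) : 0 <= t -> s <= s <= s + t by move=> t0; rewrite lexx lerDl.
  have in1 (s t : R) : 0 <= t -> s <= s + t <= s + t by move=> t0; rewrite lexx lerDl t0.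
  apply: quarter => //; rewrite -WS -HS.
  - by apply: (all_ok (p.1, p.2)); apply: in0.
  - by apply: (all_ok (p.1 + W n.+1, p.2)); [apply: in1 | apply: in0].
  - by apply: (all_ok (p.1, p.2 + H n.+1)); [apply: in0 | apply: in1].
  - by apply: (all_ok (p.1 + W n.+1, p.2 + H n.+1)); apply: in1.
have [F FP] := choice (fun np : nat * (R * R) => step np.1 np.2).
pose s := fix s n := if n is k.+1 then F (k, s k) else (a, c).
have bads n : bad n (s n).
  elim: n => [|n IH]; first by rewrite /bad /W /H expr0 !divr1.
  by have [] := FP (n, s n) IH.
have [x xP] : exists x, forall n, (s n).1 <= x <= (s n).1 + W n.
  apply: nested_halving => // n; by have [_ + _] := FP (n, s n) (bads n).
have [y yP] : exists y, forall n, (s n).2 <= y <= (s n).2 + H n.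
  apply: nested_halving => // n; by have [_ _] := FP (n, s n) (bads n).
have [||e e0 Pe] := small x y.
  by have := xP 0%N; rewrite /W expr0 divr1.
  by have := yP 0%N; rewrite /H expr0 divr1.
have [n ne] := halving_lt (w + h) e0.
apply: (bads n); by apply: Pe => //; rewrite /W /H -mulrDl.
Qed.

(** The integral of f along the boundary of a rectangle. Putting opposite sides
    under one integral sign makes the integrands constant for an affine f, whose
    integral is then seen to vanish without integrating x dx. *)
Definition rect_int f a c w h : Cplane R :=
  cint a (a + w) (fun x => f (x +i* c) - f (x +i* (c + h))) +
  'i * cint c (c + h) (fun y => f ((a + w) +i* y) - f (a +i* y)).

Definition rect_diff f a c w h := forall x y,
  a <= x <= a + w -> c <= y <= c + h -> cdiff f (x +i* y).

Lemma csegment_hor f a b y :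
  (forall x, a <= x <= b -> cdiff f (x +i* y)) ->
  csegment a b (fun x => f (x +i* y)).
Proof.
move=> df x /df /cdiff_continuous fx.
have cx : (fun t => t +i* y : Cplane R) @ x --> (x +i* y : Cplane R).
  exact: (cvg_Complex cvg_id (cvg_cst _)).
exact: (cvg_comp _ _ cx fx).
Qed.

Lemma csegment_ver f a b x :
  (forall y, a <= y <= b -> cdiff f (x +i* y)) ->
  csegment a b (fun y => f (x +i* y)).
Proof.
move=> df y /df /cdiff_continuous fx.
have cx : (fun t => x +i* t : Cplane R) @ y --> (x +i* y : Cplane R).
  exact: (cvg_Complex (cvg_cst _) cvg_id).
exact: (cvg_comp _ _ cx fx).
Qed.

Lemma rect_int_quarter f a c w h : 0 <= w -> 0 <= h -> rect_diff f a c w h ->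
  rect_int f a c w h =
  rect_int f a c (w / 2) (h / 2) + rect_int f (a + w / 2) c (w / 2) (h / 2) +
  (rect_int f a (c + h / 2) (w / 2) (h / 2) +
   rect_int f (a + w / 2) (c + h / 2) (w / 2) (h / 2)).
Proof.
move=> w0 h0 df.
have aw : a + w / 2 + w / 2 = a + w by rewrite -addrA -splitr.
have ch : c + h / 2 + h / 2 = c + h by rewrite -addrA -splitr.
have hor y : c <= y <= c + h -> csegment a (a + w) (fun x => f (x +i* y)).
  by move=> cy; apply: csegment_hor => x ax; exact: df.
have ver x : a <= x <= a + w -> csegment c (c + h) (fun y => f (x +i* y)).
  by move=> ax; apply: csegment_ver => y cy; exact: df.
have hsplit y : c <= y <= c + h -> cint a (a + w) (fun x => f (x +i* y)) =
    cint a (a + w / 2) (fun x => f (x +i* y)) +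
    cint (a + w / 2) (a + w) (fun x => f (x +i* y)).
  by move=> cy; apply: cint_cat (hor _ cy); lra.
have vsplit x : a <= x <= a + w -> cint c (c + h) (fun y => f (x +i* y)) =
    cint c (c + h / 2) (fun y => f (x +i* y)) +
    cint (c + h / 2) (c + h) (fun y => f (x +i* y)).
  by move=> ax; apply: cint_cat (ver _ ax); lra.
have hor1 y : c <= y <= c + h -> csegment a (a + w / 2) (fun x => f (x +i* y)).
  by move=> cy; apply: csegment_sub (hor _ cy); lra.
have hor2 y : c <= y <= c + h -> csegment (a + w / 2) (a + w) (fun x => f (x +i* y)).
  by move=> cy; apply: csegment_sub (hor _ cy); lra.
have ver1 x : a <= x <= a + w -> csegment c (c + h / 2) (fun y => f (x +i* y)).
  by move=> cy; apply: csegment_sub (ver _ cy); lra.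
have ver2 x : a <= x <= a + w -> csegment (c + h / 2) (c + h) (fun y => f (x +i* y)).
  by move=> cy; apply: csegment_sub (ver _ cy); lra.
have ya : c <= c <= c + h by lra.
have yb : c <= c + h / 2 <= c + h by lra.
have yc : c <= c + h <= c + h by lra.
have xa : a <= a <= a + w by lra.
have xb : a <= a + w / 2 <= a + w by lra.
have xc : a <= a + w <= a + w by lra.
rewrite /rect_int aw ch !cintB //; try exact: hor; try exact: ver;
  try exact: hor1; try exact: hor2; try exact: ver1; try exact: ver2.
rewrite !hsplit // !vsplit //.
ring.
Qed.

(** Near z the function f is affine up to an error that is small relative to the
    distance from z, and the integral of an affine function vanishes. *)
Lemma rect_int_small f (z : Cplane R) e : cdiff f z -> 0 < e ->
  exists2 d, 0 < d & forall a c w h, 0 <= w -> 0 <= h -> w + h < d ->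
    a <= Re z <= a + w -> c <= Im z <= c + h -> rect_diff f a c w h ->
    cmod (rect_int f a c w h) <= e * (w + h) ^+ 2.
Proof.
move=> [q qz fE] e0.
have e20 : 0 < e / 2 by rewrite divr_gt0.
have /nbhsCP[d d0 qd] : \forall t \near z, cmod (q t - q z) < e / 2.
  by move/cvgCP: qz; exact.
exists d => // a c w h w0 h0 whd az cz df.
pose g t := f t - (f z + q z * (t - z)).
have gE t : g t = (q t - q z) * (t - z) by rewrite /g fE; ring.
have gb (x y : R) : a <= x <= a + w -> c <= y <= c + h ->
    cmod (g (x +i* y)) <= e / 2 * (w + h).
  move=> ax cy; have xyz : cmod (x +i* y - z) <= w + h.
    apply: le_trans (cmod_le_ReIm _) _; case: (z) az cz => p r /= az cz.
    by apply: lerD; rewrite ler_norml; apply/andP; split; lra.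
  rewrite gE cmodM; apply: ler_pM; rewrite ?cmod_ge0 //.
  by apply/ltW/qd; exact: le_lt_trans whd.
have hor y : c <= y <= c + h -> csegment a (a + w) (fun x => f (x +i* y)).
  by move=> cy; apply: csegment_hor => x ax; exact: df.
have ver x : a <= x <= a + w -> csegment c (c + h) (fun y => f (x +i* y)).
  by move=> ax; apply: csegment_ver => y cy; exact: df.
have ya : c <= c <= c + h by lra.
have yc : c <= c + h <= c + h by lra.
have xa : a <= a <= a + w by lra.
have xc : a <= a + w <= a + w by lra.
pose kx : Cplane R := q z * (- ('i * h%:C)).
pose ky : Cplane R := q z * w%:C.
pose F x := f (x +i* c) - f (x +i* (c + h)).
pose G y := f ((a + w) +i* y) - f (a +i* y).
have cF : csegment a (a + w) F by apply: (csegmentB (hor _ ya) (hor _ yc)).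
have cG : csegment c (c + h) G by apply: (csegmentB (ver _ xc) (ver _ xa)).
have -> : rect_int f a c w h = cint a (a + w) (fun x => F x - kx) +
    'i * cint c (c + h) (fun y => G y - ky).
  rewrite (cintB cF (@csegment_cst _ _ _ _)) (cintB cG (@csegment_cst _ _ _ _)).
  rewrite !cint_cst ?lerDl // ![_ + _ - _]addrAC !subrr !add0r /rect_int.
  rewrite /kx /ky; ring.
have e2 : e / 2 * (w + h) + e / 2 * (w + h) = e * (w + h) by field.
apply: le_trans (cmodD _ _) _; rewrite cmodM cmodi mul1r.
have -> : e * (w + h) ^+ 2 = e * (w + h) * (a + w - a) + e * (w + h) * (c + h - c).
  by ring.
have aw : a <= a + w by rewrite lerDl.
have ch : c <= c + h by rewrite lerDl.
apply: lerD.
- apply: (cint_bound aw (csegmentB cF (@csegment_cst _ _ _ kx))) => x ax.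
  have -> : F x - kx = g (x +i* c) - g (x +i* (c + h)).
    rewrite /F /kx /g; have -> : x +i* (c + h) = x +i* c + 'i * h%:C :> Cplane R.
      by apply/eqP; rewrite eq_complex /=; apply/andP; split; apply/eqP; ring.
    by ring.
  by apply: le_trans (cmodB _ _) _; rewrite -e2; apply: lerD; exact: gb.
- apply: (cint_bound ch (csegmentB cG (@csegment_cst _ _ _ ky))) => y cy.
  have -> : G y - ky = g ((a + w) +i* y) - g (a +i* y).
    rewrite /G /ky /g; have -> : (a + w) +i* y = a +i* y + w%:C :> Cplane R.
      by apply/eqP; rewrite eq_complex /=; apply/andP; split; apply/eqP; ring.
    by ring.
  by apply: le_trans (cmodB _ _) _; rewrite -e2; apply: lerD; exact: gb.
Qed.

(** The bound of rect_int_small is inherited by a rectangle from its quarters: four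
    quarters of half the size have the same total squared size. *)
Lemma goursat f a c w h : 0 <= w -> 0 <= h -> rect_diff f a c w h ->
  rect_int f a c w h = 0.
Proof.
move=> w0 h0 df; apply/eqP; rewrite -cmod_eq0 eq_le cmod_ge0 andbT.
apply/ler_addgt0Pl => e e0; rewrite addr0.
pose k := e / ((w + h) ^+ 2 + 1).
have s1 : 0 < (w + h) ^+ 2 + 1 by rewrite ltr_wpDl ?sqr_ge0.
have k0 : 0 < k by rewrite divr_gt0.
apply: (@le_trans _ _ (k * (w + h) ^+ 2)); last first.
  by rewrite /k mulrAC ler_pdivrMr // ler_pM2l // lerDl.
suff : rect_diff f a c w h -> cmod (rect_int f a c w h) <= k * (w + h) ^+ 2.
  exact.
apply: (@rectangle_bisection (fun a c w h => rect_diff f a c w h ->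
  cmod (rect_int f a c w h) <= k * (w + h) ^+ 2)) => //.
  move=> a' c' w' h' w'0 h'0 Q1 Q2 Q3 Q4 d'.
  rewrite (rect_int_quarter w'0 h'0 d').
  have -> : k * (w' + h') ^+ 2 = k * (w' / 2 + h' / 2) ^+ 2 +
      k * (w' / 2 + h' / 2) ^+ 2 + (k * (w' / 2 + h' / 2) ^+ 2 +
      k * (w' / 2 + h' / 2) ^+ 2) by field.
  apply: le_trans (cmodD _ _) (lerD _ _); apply: le_trans (cmodD _ _) (lerD _ _).
  - by apply: Q1 => x y ? ?; apply: d'; lra.
  - by apply: Q2 => x y ? ?; apply: d'; lra.
  - by apply: Q3 => x y ? ?; apply: d'; lra.
  - by apply: Q4 => x y ? ?; apply: d'; lra.
move=> x y ax cy; have [d d0 dk] := rect_int_small (df x y ax cy) k0.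
by exists d => // a' c' w' h' w'0 h'0 whd ax' cy'; exact: dk.
Qed.

End Goursat.

Arguments rect_int : simpl never.

(** * The complex exponential *)

Section ComplexExponential.
Context {R : realType}.
Implicit Types (z w a : Cplane R) (e s t x y : R).
Local Open Scope complex_scope.

Definition cexp z : Cplane R :=
  (expR (Re z) * cos (Im z)) +i* (expR (Re z) * sin (Im z)).

Lemma cexpD z w : cexp (z + w) = cexp z * cexp w.
Proof.
case: z w => [a b] [c d]; rewrite /cexp /= expRD cosD sinD.
by apply/eqP; rewrite eq_complex /=; apply/andP; split; apply/eqP; ring.
Qed.

Lemma cmod_cexp z : cmod (cexp z) = expR (Re z).
Proof.
rewrite /cmod /= !exprMn -mulrDr cos2Dsin2 mulr1 sqrtr_sqr.
by rewrite gtr0_norm ?expR_gt0.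
Qed.

Lemma cexp_neq0 z : cexp z != 0.
Proof. by rewrite -cmod_gt0 cmod_cexp expR_gt0. Qed.

Lemma cexp_2pi s : cexp (s +i* (pi *+ 2)) = cexp (s +i* 0).
Proof. by rewrite /cexp /= cos2pi sin2pi cos0 sin0. Qed.

Lemma cexp_polar z s : cmod z = expR s ->
  exists2 t, `|t| <= pi & z = cexp (s +i* t).
Proof.
case: z => p q zs; pose r := expR s; have r0 : 0 < r := expR_gt0 s.
have pq : p ^+ 2 + q ^+ 2 = r ^+ 2.
  by rewrite /r -zs /cmod /= sqr_sqrtr // addr_ge0 ?sqr_ge0.
pose u := p / r; have u1 : -1 <= u <= 1.
  rewrite -ler_norml /u normrM normfV (gtr0_norm r0) ler_pdivrMr // mul1r.
  by rewrite -(gtr0_norm r0) -ler_sqr ?nnegrE // !real_normK ?num_real // -pq lerDl sqr_ge0.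
have cu : cos (acos u) = u by apply: acosK; rewrite in_itv.
have su : r * sin (acos u) = `|q|.
  rewrite sin_acos // -{1}(gtr0_norm r0) -sqrtr_sqr -sqrtrM ?sqr_ge0 //.
  rewrite mulrBr mulr1 -exprMn /u mulrC divfK ?gt_eqF // -pq addrC addKr.
  by rewrite sqrtr_sqr.
have pE : p = r * u by rewrite /u mulrC divfK // gt_eqF.
have tpi : `|acos u| <= pi by rewrite ger0_norm ?acos_ge0 ?acos_lepi.
have [q0|q0] := leP 0 q.
  exists (acos u) => //; rewrite /cexp /= cu -/r -pE su.
  by rewrite ger0_norm.
exists (- acos u); first by rewrite normrN.
rewrite /cexp /= cosN sinN cu -/r -pE mulrN su.
by rewrite ltr0_norm // opprK.
Qed.

Lemma is_derive_expand (f : R -> R) l e : is_derive (0 : R) 1 f l -> 0 < e ->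
  exists2 d, 0 < d & forall x, `|x| < d -> `|f x - f 0 - l * x| <= e * `|x|.
Proof.
move=> df e0.
have /cvgrPdist_le /(_ e e0) : h^-1 *: (f (h *: 1 + 0) - f 0) @[h --> 0^'] --> l.
  by rewrite -(@derive_val _ _ _ _ _ _ _ df); exact: ex_derive.
rewrite near_withinE => /nbhs_ballP[d d0 dl]; exists d => // x xd.
have [->|x0] := eqVneq x 0; first by rewrite mulr0 subrr subr0 normr0 mulr0.
have := dl x; rewrite /ball /= sub0r normrN => /(_ xd x0).
rewrite addr0 /GRing.scale /= mulr1 => H.
have -> : f x - f 0 - l * x = - ((l - x^-1 * (f x - f 0)) * x) by field.
by rewrite normrN normrM ler_wpM2r.
Qed.

(** Reduces to the expansions of exp, cos and sin at 0, as
    exp(x + iy) - 1 - x - iy = (e^x - 1 - x) + e^x (cos y - 1)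
      + i (e^x (sin y - y) + (e^x - 1) y). *)
Lemma cexp_expand e : 0 < e -> exists2 d, 0 < d & forall z, cmod z < d ->
  cmod (cexp z - 1 - z) <= e * cmod z.
Proof.
move=> e0; pose k := Num.min (e / 6) 1.
have k0 : 0 < k by rewrite lt_min divr_gt0 //=.
have k1 : k <= 1 by rewrite ge_min lexx orbT.
have ke : 6 * k <= e.
  have : k <= e / 6 by rewrite ge_min lexx.
  lra.
have [d1 d1_0 H1] := is_derive_expand (is_derive_expR 0) k0.
have [d2 d2_0 H2] := is_derive_expand (is_derive_cos 0) k0.
have [d3 d3_0 H3] := is_derive_expand (is_derive_sin 0) k0.
pose d := Num.min (Num.min d1 d2) (Num.min d3 (k / 2)).
exists d; first by rewrite !lt_min d1_0 d2_0 d3_0 divr_gt0.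
move=> [x y] zd.
have xd : `|x| < d := le_lt_trans (Re_le_cmod (x +i* y)) zd.
have yd : `|y| < d := le_lt_trans (Im_le_cmod (x +i* y)) zd.
move: xd yd; rewrite !lt_min.
move=> /andP[/andP[xd1 _] /andP[_ xk]] /andP[/andP[_ yd2] /andP[yd3 _]].
have E : `|expR x - 1 - x| <= k * `|x| by have := H1 x xd1; rewrite expR0 mul1r.
have C : `|cos y - 1| <= k * `|y|.
  by have := H2 y yd2; rewrite cos0 sin0 oppr0 mul0r subr0.
have S : `|sin y - y| <= k * `|y|.
  by have := H3 y yd3; rewrite sin0 cos0 subr0 mul1r.
have ex : `|expR x - 1| <= 2 * `|x|.
  rewrite -(subrK x (expR x - 1)); apply: le_trans (ler_normD _ _) _.
  have := normr_ge0 x; nra.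
have ex2 : `|expR x| <= 2.
  rewrite -(subrK 1 (expR x)); apply: le_trans (ler_normD _ _) _.
  rewrite normr1; lra.
have xz : `|x| <= cmod (x +i* y) := Re_le_cmod (x +i* y).
have yz : `|y| <= cmod (x +i* y) := Im_le_cmod (x +i* y).
have := cmod_ge0 (x +i* y); set m := cmod (x +i* y) in xz yz * => m0.
apply: le_trans (cmod_le_ReIm _) _; rewrite /cexp /= subr0.
have -> : expR x * cos y - 1 - x = (expR x - 1 - x) + expR x * (cos y - 1) by ring.
have -> : expR x * sin y - y = expR x * (sin y - y) + (expR x - 1) * y by ring.
have B1 : `|expR x * (cos y - 1)| <= 2 * (k * `|y|).
  by rewrite normrM; apply: ler_pM.
have B2 : `|expR x * (sin y - y)| <= 2 * (k * `|y|).
  by rewrite normrM; apply: ler_pM.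
have B3 : `|(expR x - 1) * y| <= k * `|y|.
  rewrite normrM; apply: ler_wpM2r => //; lra.
apply: le_trans (lerD (ler_normD _ _) (ler_normD _ _)) _.
nra.
Qed.

Lemma cdiff_cexp a : cdiff cexp a.
Proof.
exists (fun z => if z == a then cexp a else (cexp z - cexp a) / (z - a)).
  rewrite eqxx; apply/cvgCP => e e0.
  have a0 := cexp_neq0 a; have ma : 0 < cmod (cexp a) by rewrite cmod_gt0.
  have k0 : 0 < e / cmod (cexp a) / 2 by rewrite !divr_gt0.
  have [d d0 dE] := cexp_expand k0.
  apply: filterS (near_ballC a d0) => z zd.
  case: eqVneq => [_|za]; first by rewrite subrr cmod0.
  have za0 : z - a != 0 by rewrite subr_eq0.
  have -> : (cexp z - cexp a) / (z - a) - cexp a =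
      cexp a * ((cexp (z - a) - 1 - (z - a)) / (z - a)).
    by rewrite -{1}(subrK a z) cexpD; field.
  rewrite cmodM cmod_div mulrC -ltr_pdivlMr // ltr_pdivrMr ?cmod_gt0 //.
  apply: le_lt_trans (dE _ zd) _; rewrite ltr_pM2r ?cmod_gt0 //.
  by rewrite ltr_pdivrMr // ltr_pMr ?divr_gt0 // ltr1n.
move=> z; case: eqVneq => [->|za]; first by rewrite subrr mulr0 addr0.
by rewrite divfK ?subr_eq0 // addrC subrK.
Qed.

End ComplexExponential.

Arguments cexp : simpl never.

(** * Circle means and Cauchy's formula *)

Section CircleMeans.
Context {R : realType}.
Implicit Types (f F : Cplane R -> Cplane R) (z w a : Cplane R).
Implicit Types (d e m r s t : R).
Local Open Scope complex_scope.
Local Notation tau := (pi *+ 2 : R).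

Lemma tau_gt0 : 0 < tau.
Proof. by rewrite mulrn_wgt0 // pi_gt0. Qed.

(** The integral of F over the circle of radius exp s with respect to the
    angle, that is, of F(z) dz / (iz). *)
Definition circle_int F s := cint 0 tau (fun t => F (cexp (s +i* t))).

Arguments circle_int : simpl never.

Lemma cexp_line_continuous s t :
  (fun u => cexp (s +i* u)) @ t --> cexp (s +i* t).
Proof.
have h : (fun u => s +i* u : Cplane R) @ t --> (s +i* t : Cplane R).
  exact: (cvg_Complex (cvg_cst _) cvg_id).
exact: (cvg_comp _ _ h (cdiff_continuous (@cdiff_cexp _ _))).
Qed.

Lemma csegment_circle F s : (forall z, cmod z = expR s -> F @ z --> F z) ->
  csegment 0 tau (fun t => F (cexp (s +i* t))).
Proof.
move=> cF t _; have Fz : F @ cexp (s +i* t) --> F (cexp (s +i* t)).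
  by apply: cF; rewrite cmod_cexp.
exact: (cvg_comp _ _ (@cexp_line_continuous s t) Fz).
Qed.

Lemma circle_int_bound F s m :
  (forall z, cmod z = expR s -> F @ z --> F z) ->
  (forall z, cmod z = expR s -> cmod (F z) <= m) ->
  cmod (circle_int F s) <= m * tau.
Proof.
move=> cF Fm; rewrite -[X in m * X]subr0.
apply: (cint_bound (ltW tau_gt0) (csegment_circle cF)) => t _.
by apply: Fm; rewrite cmod_cexp.
Qed.

Lemma circle_int_cst k s : circle_int (fun=> k) s = tau%:C * k.
Proof. by rewrite /circle_int cint_cst ?subr0 // ltW // tau_gt0. Qed.

Lemma circle_intB F f s : (forall z, cmod z = expR s -> F @ z --> F z) ->
  (forall z, cmod z = expR s -> f @ z --> f z) ->
  circle_int (fun z => F z - f z) s = circle_int F s - circle_int f s.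
Proof.
move=> cF cf; exact: (cintB (csegment_circle cF) (csegment_circle cf)).
Qed.

Lemma circle_intZ k F s : (forall z, cmod z = expR s -> F @ z --> F z) ->
  circle_int (fun z => k * F z) s = k * circle_int F s.
Proof. by move=> cF; exact: (cintZ k (csegment_circle cF)). Qed.

Lemma eq_circle_int F f s : (forall z, cmod z = expR s -> F z = f z) ->
  circle_int F s = circle_int f s.
Proof. by move=> Ff; apply: eq_cint => t _; apply: Ff; rewrite cmod_cexp. Qed.

(** Goursat's theorem for F o exp on a rectangle of height 2 pi: the horizontal
    sides cancel by periodicity. *)
Lemma circle_int_annulus F s1 s2 : s1 <= s2 ->
  (forall z, expR s1 <= cmod z <= expR s2 -> cdiff F z) ->
  circle_int F s1 = circle_int F s2.
Proof.
move=> s12 dF.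
have s21 : 0 <= s2 - s1 by rewrite subr_ge0.
have dG : rect_diff (F \o cexp) s1 0 (s2 - s1) tau.
  move=> x y; rewrite addrC subrK => /andP[x1 x2] _.
  apply: cdiff_comp (@cdiff_cexp _ _) (dF _ _).
  by rewrite cmod_cexp /= !ler_expR x1 x2.
have := goursat s21 (ltW tau_gt0) dG; rewrite /rect_int.
rewrite (@eq_cint _ _ _ _ (fun=> 0)); last first.
  by move=> x _; rewrite /= add0r cexp_2pi subrr.
have -> : s1 + (s2 - s1) = s2 by rewrite addrC subrK.
rewrite (cint_cst 0 s12) mulr0 !add0r => /eqP; rewrite mulf_eq0.
have -> : (('i : R[i]) == 0) = false by rewrite eq_complex /= oner_eq0 andbF.
have cF s : s1 <= s <= s2 -> forall z, cmod z = expR s -> F @ z --> F z.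
  by move=> ss z zs; apply/cdiff_continuous/dF; rewrite zs !ler_expR.
have c1 : csegment 0 tau (fun t => F (cexp (s1 +i* t))).
  by apply/csegment_circle/cF; rewrite lexx s12.
have c2 : csegment 0 tau (fun t => F (cexp (s2 +i* t))).
  by apply/csegment_circle/cF; rewrite s12 lexx.
by move/eqP => I0; apply/esym/subr0_eq; rewrite -I0; apply/esym/(cintB c2 c1).
Qed.

(** F o exp is uniformly continuous near a compact vertical segment. *)
Lemma circle_int_continuous F s d : 0 < d ->
  (forall z, expR (s - d) < cmod z < expR (s + d) -> F @ z --> F z) ->
  forall e, 0 < e -> \forall s' \near s,
    cmod (circle_int F s' - circle_int F s) <= e.
Proof.
move=> d0 cF e e0; pose k := e / tau.
have k0 : 0 < k by rewrite divr_gt0 // tau_gt0.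
have k20 : 0 < k / 2 by rewrite divr_gt0.
have cFs s' : `|s' - s| < d -> forall z, cmod z = expR s' -> F @ z --> F z.
  by move=> ss z zs; apply: cF; rewrite zs !ltr_expR; move: ss; rewrite ltr_norml; lra.
have ss : `|s - s| < d by rewrite subrr normr0.
have near_circle : \forall s' \near s, `[0, tau] `<=`
    [set t | cmod (F (cexp (s' +i* t)) - F (cexp (s +i* t))) < k].
  have /compact_near_coveringP := @segment_compact R 0 tau.
  pose P s' t := cmod (F (cexp (s' +i* t)) - F (cexp (s +i* t))) < k.
  move=> /(_ _ (nbhs s) P (nbhs_filter s)); apply => t _; have Ft := cFs s ss (cexp (s +i* t)).
  have {}Ft : F @ cexp (s +i* t) --> F (cexp (s +i* t)).
    by apply: Ft; rewrite cmod_cexp.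
  have Ht : (fun p : R * R => cexp (p.2 +i* p.1)) @ (t, s) --> cexp (s +i* t).
    have h : (fun p : R * R => p.2 +i* p.1 : Cplane R) @ (t, s) -->
        (s +i* t : Cplane R).
      exact: (cvg_Complex cvg_snd cvg_fst).
    exact: (cvg_comp _ _ h (cdiff_continuous (@cdiff_cexp _ _))).
  have /cvgCP /(_ _ k20) H1 := cvg_comp _ _ Ht Ft.
  have /cvgCP /(_ _ k20) H2 := cvg_comp _ _ (@cexp_line_continuous s t) Ft.
  have {}H2 : \forall p \near ((t, s) : R * R),
      cmod (F (cexp (s +i* p.1)) - F (cexp (s +i* t))) < k / 2.
    exact: (cvg_fst H2).
  suff H : \forall p \near ((t, s) : R * R), P p.2 p.1 by exact: H.
  apply: filterS2 H1 H2 => -[t' s'] /= h1 h2; rewrite /P.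
  have := cmod_dist (F (cexp (s' +i* t'))) (F (cexp (s +i* t'))) (F (cexp (s +i* t))).
  rewrite [in X in _ <= _ + X]cmodC; lra.
have near_d : \forall s' \near s, `|s' - s| < d.
  by apply: filterS (nbhsx_ballx s d d0) => s'; rewrite /ball /= distrC.
apply: filterS2 near_circle near_d => s' ks' ds'.
have c1 := csegment_circle (cFs s' ds'); have c2 := csegment_circle (cFs s ss).
rewrite /circle_int -(cintB c1 c2).
have -> : e = k * (tau - 0) by rewrite subr0 /k divfK // gt_eqF // tau_gt0.
apply: (cint_bound (ltW tau_gt0) (csegmentB c1 c2)) => t tt.
by apply/ltW/ks'; rewrite /= in_itv.
Qed.

Lemma cmod_le_eps z : (forall e, 0 < e -> cmod z <= e) -> z = 0.
Proof.
move=> ze; apply/eqP; rewrite -cmod_eq0 eq_le cmod_ge0 andbT.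
by apply/ler_addgt0Pl => e e0; rewrite addr0 ze.
Qed.

(** The integral is constant on both sides of the exceptional circle and depends
    continuously on the radius. *)
Lemma circle_int_annulus_except F s0 s1 s2 : s1 < s0 -> s0 < s2 ->
  (forall z, expR s1 <= cmod z <= expR s2 -> F @ z --> F z) ->
  (forall z, expR s1 <= cmod z <= expR s2 -> cmod z != expR s0 -> cdiff F z) ->
  circle_int F s1 = circle_int F s2.
Proof.
move=> s10 s02 cF dF; apply/eqP; rewrite -subr_eq0; apply/eqP.
apply: cmod_le_eps => e e0; have e20 : 0 < e / 2 by rewrite divr_gt0.
pose d := Num.min (s0 - s1) (s2 - s0).
have d0 : 0 < d by rewrite lt_min !subr_gt0 s10.
have d1 : d <= s0 - s1 by rewrite ge_min lexx.
have d2 : d <= s2 - s0 by rewrite ge_min lexx orbT.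
have cF0 z : expR (s0 - d) < cmod z < expR (s0 + d) -> F @ z --> F z.
  move=> /andP[z1 z2]; apply: cF; apply/andP; split.
    by apply: le_trans (ltW z1); rewrite ler_expR; lra.
  by apply: le_trans (ltW z2) _; rewrite ler_expR; lra.
have /nbhs_ballP[k /= k0 ks] := circle_int_continuous d0 cF0 e20.
pose h := Num.min (k / 2) d.
have h0 : 0 < h by rewrite lt_min d0 divr_gt0.
have hk : h <= k / 2 by rewrite ge_min lexx.
have hd : h <= d by rewrite ge_min lexx orbT.
have -> : circle_int F s1 = circle_int F (s0 - h).
  apply: circle_int_annulus; first lra.
  move=> z /andP[z1 z2]; have z0 : cmod z < expR s0.
    by apply: le_lt_trans z2 _; rewrite ltr_expR; lra.
  apply: dF; last by rewrite lt_eqF.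
  by rewrite z1 (le_trans (ltW z0)) // ler_expR ltW.
have <- : circle_int F (s0 + h) = circle_int F s2.
  apply: circle_int_annulus; first lra.
  move=> z /andP[z1 z2]; have z0 : expR s0 < cmod z.
    by apply: lt_le_trans z1; rewrite ltr_expR; lra.
  apply: dF; last by rewrite gt_eqF.
  by rewrite z2 andbT; apply: le_trans (ltW z0); rewrite ler_expR ltW.
apply: le_trans (cmod_dist _ _ (circle_int F s0)) _.
rewrite [in X in _ + X]cmodC [e]splitr; apply: lerD; apply: ks;
  by rewrite /ball /= ltr_norml; apply/andP; split; lra.
Qed.

Lemma expR_small e s : 0 < e -> exists2 s', s' <= s & expR s' < e.
Proof.
move=> e0; exists (Num.min s (ln (e / 2))); first by rewrite ge_min lexx.
apply: (@le_lt_trans _ _ (expR (ln (e / 2)))).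
  by rewrite ler_expR ge_min lexx orbT.
by rewrite lnK ?posrE ?divr_gt0 // ltr_pdivrMr // ltr_pMr // ltr1n.
Qed.

(** The mean value property. The integral does not depend on the radius, so that
    continuity is all that is asked at the center. *)
Lemma circle_int_center f s : (forall z, cmod z <= expR s -> f @ z --> f z) ->
  (forall z, 0 < cmod z <= expR s -> cdiff f z) ->
  circle_int f s = tau%:C * f 0.
Proof.
move=> cf df; apply/eqP; rewrite -subr_eq0; apply/eqP.
apply: cmod_le_eps => e e0; have k0 : 0 < e / tau by rewrite divr_gt0 // tau_gt0.
have f0 : f @ (0 : Cplane R) --> f 0 by apply: cf; rewrite cmod0 expR_ge0.
have /nbhsCP[d d0 fd] : \forall z \near (0 : Cplane R), cmod (f z - f 0) < e / tau.
  by move/cvgCP : f0; exact.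
have [s' s's ds'] := expR_small s d0.
have cs' z : cmod z = expR s' -> f @ z --> f z.
  by move=> zs; apply: cf; rewrite zs ler_expR.
rewrite -(@circle_int_annulus f s' s) //; last first.
  by move=> z /andP[z1 z2]; apply: df; rewrite z2 (lt_le_trans _ z1) // expR_gt0.
rewrite -(circle_int_cst (f 0) s') -(circle_intB cs' (fun z _ => @cvgC_cst _ (f 0) z)).
have -> : e = e / tau * tau by rewrite divfK // gt_eqF // tau_gt0.
apply: circle_int_bound.
  by move=> z zs; exact: (cvgCB (cs' z zs) (@cvgC_cst _ _ z)).
by move=> z zs; apply/ltW/fd; rewrite subr0 zs.
Qed.

(** The integral does not depend on the radius, and z / (z - a) tends to 1 on
    large circles. *)
Lemma circle_int_winding a s : cmod a < expR s ->
  circle_int (fun z => z / (z - a)) s = tau%:C.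
Proof.
move=> as'; have dza z : cmod a < cmod z -> z - a != 0.
  by rewrite subr_eq0; apply: contraTneq => ->; rewrite ltxx.
have dg z : cmod a < cmod z -> cdiff (fun z => z / (z - a)) z.
  move=> az; have dz := cdiffB (cdiff_id z) (cdiff_cst a z).
  exact: (@cdiff_div _ id (fun w => w - a) z (dza z az) (cdiff_id z) dz).
apply/eqP; rewrite -subr_eq0; apply/eqP; apply: cmod_le_eps => e e0.
have k0 : 0 < e / tau by rewrite divr_gt0 // tau_gt0.
pose r := Num.max (expR s) (cmod a + cmod a / (e / tau)).
have r0 : 0 < r by rewrite lt_max expR_gt0.
have rE : expR (ln r) = r by rewrite lnK.
have ra : cmod a < r by rewrite lt_max as'.
rewrite (@circle_int_annulus _ s (ln r)); first last.
- by move=> z /andP[z1 _]; apply: dg; exact: lt_le_trans z1.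
- by rewrite -ler_expR rE le_max lexx.
have -> : tau%:C = circle_int (fun=> 1) (ln r) :> R[i].
  by rewrite circle_int_cst mulr1.
have cr z : cmod z = expR (ln r) -> (fun z => z / (z - a)) @ z --> z / (z - a).
  by rewrite rE => zr; apply: (cdiff_continuous (dg z _)); rewrite zr.
rewrite -(circle_intB cr (fun z _ => @cvgC_cst _ 1 z)).
have -> : e = e / tau * tau by rewrite divfK // gt_eqF // tau_gt0.
apply: circle_int_bound => z zr.
  exact: (cvgCB (cr z zr) (@cvgC_cst _ _ z)).
rewrite rE in zr; have za : z - a != 0 by apply: dza; rewrite zr.
have -> : z / (z - a) - 1 = a / (z - a) by field.
rewrite cmod_div ler_pdivrMr ?cmod_gt0 //.
have := cmod_subl z a; rewrite zr => zar.
have : cmod a / (e / tau) <= r - cmod a.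
  by rewrite lerBrDl le_max lexx orbT.
rewrite ler_pdivrMr // mulrC => H; apply: le_trans H _.
by rewrite ler_wpM2l // ltW.
Qed.

(** The difference quotient q(z) = (f z - f a) / (z - a) extends continuously to
    a, so the integral of z q(z) over circles around 0 does not change when the
    circle passes through a; it vanishes, by the mean value property at 0. Only
    continuity is asked at 0, which is what removable singularities need. *)
Lemma cauchy_formula f a r s : expR s < r -> cmod a < expR s ->
  (forall z, cmod z < r -> f @ z --> f z) ->
  (forall z, 0 < cmod z < r -> cdiff f z) ->
  circle_int (fun z => f z * (z / (z - a))) s = tau%:C * f a.
Proof.
move=> sr as' cf df.
have cfs z : cmod z = expR s -> f @ z --> f z by move=> zs; apply: cf; rewrite zs.
have [->|a0] := eqVneq a 0.
  rewrite -(@circle_int_center f s).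
  - apply: eq_circle_int => z zs; rewrite subr0 divff ?mulr1 //.
    by rewrite -cmod_gt0 zs expR_gt0.
  - by move=> z zs; apply: cf; exact: le_lt_trans sr.
  - by move=> z /andP[z0 zs]; apply: df; rewrite z0; exact: le_lt_trans sr.
have ma : 0 < cmod a by rewrite cmod_gt0.
have dfa : cdiff f a by apply: df; rewrite ma (lt_trans as').
have [q qa fE] := dfa.
have qE z : z != a -> {near z, (fun w => (f w - f a) / (w - a)) =1 q}.
  move=> za; apply: filterS (near_ballC z (e := cmod (z - a)) _); last first.
    by rewrite cmod_gt0 subr_eq0.
  move=> w wz; have wa : w - a != 0.
    by apply: contraTneq wz => /subr0_eq ->; rewrite cmodC ltxx.
  by rewrite fE [f a + _]addrC addrK mulfK.
have dq z : z != a -> 0 < cmod z < r -> cdiff q z.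
  move=> za zr; apply: cdiff_near (qE z za) _.
  have dz := cdiffB (cdiff_id z) (cdiff_cst a z).
  have dn := cdiffB (df z zr) (cdiff_cst (f a) z).
  apply: (@cdiff_div _ (fun w => f w - f a) (fun w => w - a) z _ dn dz).
  by rewrite subr_eq0.
have cq z : cmod z < r -> q @ z --> q z.
  move=> zr; have [-> //|za] := eqVneq z a.
  have <- : (f z - f a) / (z - a) = q z := nbhs_singleton (qE z za).
  apply: cvg_trans (near_eq_cvg (qE z za)) _.
  have za0 : z - a != 0 by rewrite subr_eq0.
  exact: (cvgCM (cvgCB (cf z zr) (@cvgC_cst _ _ z)) (cvgCV za0 (@cvgC_sub _ a z))).
pose g z : Cplane R := q z * z.
have cg z : cmod z < r -> g @ z --> g z.
  by move=> zr; exact: (cvgCM (cq z zr) cvg_id).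
have dg z : z != a -> 0 < cmod z < r -> cdiff g z.
  by move=> za zr; exact: (cdiffM (dq z za zr) (cdiff_id z)).
have aE : expR (ln (cmod a)) = cmod a by rewrite lnK.
have [s' _ s'a] := expR_small 0 ma.
have s'r : expR s' < r by apply: lt_trans s'a (lt_trans as' sr).
have g0 : circle_int g s = 0.
  rewrite -(@circle_int_annulus_except g (ln (cmod a)) s' s).
  - rewrite circle_int_center; first by rewrite /g mulr0 mulr0.
    + by move=> z zs; apply: cg; exact: le_lt_trans s'r.
    + move=> z /andP[z0 zs]; apply: dg; last by rewrite z0 (le_lt_trans zs).
      by apply: contraTneq zs => ->; rewrite -ltNge.
  - by rewrite -ltr_expR aE.
  - by rewrite -ltr_expR aE.
  - by move=> z /andP[_ zs]; apply: cg; exact: le_lt_trans sr.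
  - rewrite aE => z /andP[z1 zs] za; apply: dg.
      by apply: contra_neq za => ->.
    by rewrite (lt_le_trans _ z1) ?expR_gt0 //= (le_lt_trans zs).
have cw z : cmod z = expR s -> (fun z => z / (z - a)) @ z --> z / (z - a).
  move=> zs; have za : z - a != 0.
    by rewrite subr_eq0; apply: contraTneq as' => <-; rewrite zs ltxx.
  exact: (cvgCM cvg_id (cvgCV za (@cvgC_sub _ a z))).
rewrite -(circle_int_winding as') mulrC -(circle_intZ (f a) cw).
apply/eqP; rewrite -subr_eq0 -circle_intB; last 2 first.
- by move=> z zs; exact: (cvgCM (cfs z zs) (cw z zs)).
- by move=> z zs; exact: (cvgCM (@cvgC_cst _ _ z) (cw z zs)).
rewrite -g0; apply/eqP/eq_circle_int => z zs; rewrite /g fE.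
have za : z - a != 0.
  by rewrite subr_eq0; apply: contraTneq as' => <-; rewrite zs ltxx.
by field.
Qed.

End CircleMeans.

Arguments circle_int : simpl never.

(** * Local consequences of Cauchy's formula *)

Section CauchyConsequences.
Context {R : realType}.
Implicit Types (f h : Cplane R -> Cplane R) (z w a b l : Cplane R).
Implicit Types (c d e r s B : R).
Local Open Scope complex_scope.
Local Notation tau := (pi *+ 2 : R).

(** Cauchy's formula at a, minus the formula at 0 and the linear term, has the
    kernel z / (z - a) - 1 - a / z = a^2 / (z (z - a)). *)
Lemma taylor1 f r r' B : 0 < r -> r < r' ->
  (forall z, cmod z < r' -> f @ z --> f z) ->
  (forall z, 0 < cmod z < r' -> cdiff f z) ->
  (forall z, cmod z = r -> cmod (f z) <= B) ->
  exists l, forall a, cmod a < r ->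
    cmod (f a - f 0 - l * a) <= B * cmod a ^+ 2 / (r * (r - cmod a)).
Proof.
move=> r0 rr' cf df fB; pose s := ln r.
have rE : expR s = r by rewrite lnK.
have tau0 : tau%:C != 0 :> R[i] by rewrite eq_complex /= gt_eqF // tau_gt0.
exists ((tau%:C)^-1 * circle_int (fun z => f z * z^-1) s) => a ar.
have sr : expR s < r' by rewrite rE.
have ar' : cmod a < expR s by rewrite rE.
have z0r : cmod (0 : Cplane R) < expR s by rewrite cmod0 expR_gt0.
have Ia := cauchy_formula sr ar' cf df; have I0 := cauchy_formula sr z0r cf df.
have cfs z : cmod z = expR s -> f @ z --> f z by move=> zs; apply: cf; rewrite zs.
have nz b z : cmod b < expR s -> cmod z = expR s -> z - b != 0.
  by move=> bs zs; rewrite subr_eq0; apply: contraTneq bs => <-; rewrite zs ltxx.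
have cq b : cmod b < expR s -> forall z, cmod z = expR s ->
    (fun z => f z * (z / (z - b))) @ z --> f z * (z / (z - b)).
  move=> bs z zs.
  exact: (cvgCM (cfs z zs) (cvgCM cvg_id (cvgCV (nz b z bs zs) (@cvgC_sub _ b z)))).
have ci z : cmod z = expR s -> (fun z => f z * z^-1) @ z --> f z * z^-1.
  move=> zs; have z0 : z != 0 by rewrite -cmod_gt0 zs expR_gt0.
  exact: (cvgCM (cfs z zs) (cvgCV z0 cvg_id)).
have cai z : cmod z = expR s ->
    (fun z => a * (f z * z^-1)) @ z --> a * (f z * z^-1).
  by move=> zs; exact: (cvgCM (@cvgC_cst _ a z) (ci z zs)).
pose k z : Cplane R := f z * (z / (z - a)) - f z * (z / (z - 0)) - a * (f z * z^-1).
have ck z : cmod z = expR s -> k @ z --> k z.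
  by move=> zs; exact: (cvgCB (cvgCB (cq a ar' z zs) (cq 0 z0r z zs)) (cai z zs)).
have Ik : tau%:C * (f a - f 0 - (tau%:C)^-1 * circle_int (fun z => f z * z^-1) s * a)
    = circle_int k s.
  have c12 z : cmod z = expR s ->
      (fun z => f z * (z / (z - a)) - f z * (z / (z - 0))) @ z -->
      f z * (z / (z - a)) - f z * (z / (z - 0)).
    by move=> zs; exact: (cvgCB (cq a ar' z zs) (cq 0 z0r z zs)).
  rewrite [RHS](circle_intB c12 cai) (circle_intB (cq a ar') (cq 0 z0r)).
  by rewrite (circle_intZ a ci) Ia I0 !mulrBr -mulrA mulVKf // [_ * a]mulrC.
have kB z : cmod z = expR s -> cmod (k z) <= B * cmod a ^+ 2 / (r * (r - cmod a)).
  move=> zs; have z0 : z != 0 by rewrite -cmod_gt0 zs expR_gt0.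
  have za := nz a z ar' zs.
  have -> : k z = f z * (a ^+ 2 / (z * (z - a))).
    by rewrite /k; field; rewrite z0 za.
  rewrite cmodM cmod_div cmodX cmodM zs rE -[leRHS]mulrA.
  have fzB : cmod (f z) <= B by apply: fB; rewrite zs rE.
  have ra0 : 0 < r - cmod a by rewrite subr_gt0.
  have za_ge : r - cmod a <= cmod (z - a) by rewrite -rE -zs cmod_subl.
  have p1 : 0 < r * (r - cmod a) by rewrite mulr_gt0.
  have p2 : r * (r - cmod a) <= r * cmod (z - a) by rewrite ler_wpM2l // ltW.
  apply: (ler_pM (cmod_ge0 _) _ fzB).
    by rewrite divr_ge0 ?exprn_ge0 ?cmod_ge0 ?mulr_ge0 ?cmod_ge0 ?ltW.
  rewrite ler_wpM2l ?exprn_ge0 ?cmod_ge0 // lef_pV2 ?posrE //.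
  exact: lt_le_trans p2.
have := circle_int_bound ck kB; rewrite -Ik cmodM cmodR gtr0_norm ?tau_gt0 //.
by rewrite mulrC ler_pM2r // tau_gt0.
Qed.

(** The expansion taylor1 does not presuppose differentiability at its center. *)
Lemma removable_singularity f b r : 0 < r ->
  (forall z, cmod (z - b) < r -> f @ z --> f z) ->
  (forall z, 0 < cmod (z - b) < r -> cdiff f z) -> cdiff f b.
Proof.
move=> r0 cf df; pose g z := f (b + 1 * z).
have gE z : f z = g (z - b) by rewrite /g mul1r addrC subrK.
have zE z : b + 1 * z - b = z by rewrite mul1r addrC addKr.
have cg z : cmod z < r -> g @ z --> g z.
  move=> zr; have fz : f @ (b + 1 * z) --> f (b + 1 * z).
    by apply: cf; rewrite zE.
  exact: (cvg_comp _ _ (cdiff_continuous (cdiff_affine 1 b z)) fz).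
have dg z : 0 < cmod z < r -> cdiff g z.
  move=> zr; have fz : cdiff f (b + 1 * z) by apply: df; rewrite zE.
  exact: (cdiff_comp (cdiff_affine 1 b z) fz).
suff dg0 : cdiff g (b - b).
  have db := cdiffB (cdiff_id b) (cdiff_cst b b).
  have := @cdiff_comp _ (fun z => z - b) g b db dg0.
  by congr (cdiff _ b); apply/funext => z /=; rewrite gE.
rewrite subrr; have r20 : 0 < r / 2 by rewrite divr_gt0.
have r2r : r / 2 < r by rewrite ltr_pdivrMr // ltr_pMr // ltr1n.
have [B gB] : exists B, forall z, cmod z = r / 2 -> cmod (g z) <= B.
  pose A := [set z : Cplane R | cmod (z - 0) <= r / 2].
  have A0 : A !=set0 by exists 0; rewrite /A /= subrr cmod0 ltW.
  have [|m _ mB] := @compact_EVT_max _ _ (cmod \o g) A A0 (@compact_disc _ 0 (r / 2)).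
    apply: continuous_in_subspaceT => z; rewrite inE /A /= subr0 => zr.
    have gz := cg z (le_lt_trans zr r2r).
    have cm : cmod @ g z --> cmod (g z).
      by have := @continuous_cmodB _ 0 (g z); rewrite /continuous_at !subr0;
         under eq_fun do rewrite subr0.
    exact: (cvg_comp _ _ gz cm).
  by exists (cmod (g m)) => z zr; apply: mB; rewrite inE /A /= subr0 zr.
have [l lB] := taylor1 r20 r2r cg dg gB.
exists (fun z => if z == 0 then l else (g z - g 0) / z); last first.
  by move=> z; case: eqVneq => [->|z0]; rewrite ?subr0 ?mulr0 ?addr0 // divfK // addrC subrK.
have B0 : 0 <= B.
  apply: le_trans (gB (r / 2)%:C _); first exact: cmod_ge0.
  by rewrite cmodR gtr0_norm.
rewrite eqxx; apply/cvgCP => e e0.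
pose K := B / (r / 2 * (r / 4)).
have K0 : 0 <= K by rewrite divr_ge0 // mulr_ge0 // ?divr_ge0 // ltW.
pose d := Num.min (r / 4) (e / (K + 1)).
have K1 : 0 < K + 1 by rewrite ltr_wpDl.
have d0 : 0 < d by rewrite lt_min !divr_gt0.
apply/nbhsCP; exists d => // z; rewrite subr0 lt_min => /andP[zr ze].
case: eqVneq => [_|z0]; first by rewrite subrr cmod0.
have mz : 0 < cmod z by rewrite cmod_gt0.
have -> : (g z - g 0) / z - l = (g z - g 0 - l * z) / z by field.
have zr2 : cmod z < r / 2 by lra.
rewrite cmod_div ltr_pdivrMr //; apply: le_lt_trans (lB z zr2) _.
apply: (@le_lt_trans _ _ (K * cmod z * cmod z)).
  have p1 : 0 < r / 2 * (r / 4) by rewrite mulr_gt0 ?divr_gt0.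
  have p2 : 0 < r / 2 * (r / 2 - cmod z) by rewrite mulr_gt0 // subr_gt0.
  have -> : K * cmod z * cmod z = B * cmod z ^+ 2 / (r / 2 * (r / 4)).
    by rewrite /K; set P := (r / 2 * _)^-1; ring.
  apply: ler_wpM2l; first by rewrite mulr_ge0 ?exprn_ge0 ?cmod_ge0.
  by rewrite lef_pV2 ?posrE // ler_wpM2l ?ltW //; lra.
rewrite ltr_pM2r //; move: ze; rewrite ltr_pdivlMr // mulrC; apply: le_lt_trans.
by rewrite ler_wpM2r ?lerDl // ltW.
Qed.

End CauchyConsequences.

(** * A disc in the image *)

Section DiscInImage.
Context {R : realType}.
Implicit Types (f h : Cplane R -> Cplane R) (z w a b l x : Cplane R).
Implicit Types (c d e m r t B K : R).
Local Open Scope complex_scope.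
Local Notation tau := (pi *+ 2 : R).

(** If h missed w, the mean value property of 1 / (h - w) would fail. *)
Lemma minimum_modulus h b r t m : 0 < t -> t < r -> 0 < m ->
  (forall z, cmod (z - b) < r -> cdiff h z) ->
  (forall z, cmod (z - b) = t -> m <= cmod (h z - h b)) ->
  forall w, cmod (w - h b) < m / 2 -> exists2 z, cmod (z - b) < r & h z = w.
Proof.
move=> t0 tr m0 dh hm w wb; apply: contrapT => nw.
have hw z : cmod (z - b) < r -> h z - w != 0.
  by move=> zr; rewrite subr_eq0; apply/eqP => hz; apply: nw; exists z.
pose k z : Cplane R := (h (b + 1 * z) - w)^-1.
have zE z : b + 1 * z - b = z by rewrite mul1r addrC addKr.
have dk z : cmod z < r -> cdiff k z.
  move=> zr; have zb : cmod (b + 1 * z - b) < r by rewrite zE.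
  have d1 := @cdiffV _ (fun z => h z - w) _ (hw _ zb) (cdiffB (dh _ zb) (cdiff_cst w _)).
  exact: (cdiff_comp (cdiff_affine 1 b z) d1).
have tE : expR (ln t) = t by rewrite lnK.
have I0 : circle_int k (ln t) = tau%:C * k 0.
  apply: circle_int_center => z; rewrite tE.
    by move=> zt; apply/cdiff_continuous/dk; exact: le_lt_trans tr.
  by move=> /andP[_ zt]; apply: dk; exact: le_lt_trans tr.
have hb0 : h b - w != 0 by apply: hw; rewrite subrr cmod0 (lt_trans t0).
have k0 : k 0 = (h b - w)^-1 by rewrite /k mulr0 addr0.
have kt z : cmod z = expR (ln t) -> cmod (k z) <= (m / 2)^-1.
  rewrite tE => zt; have zb : cmod (b + 1 * z - b) = t by rewrite zE.
  have hz := hm _ zb; rewrite /k cmodV.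
  have : m / 2 <= cmod (h (b + 1 * z) - w).
    have := cmod_dist (h (b + 1 * z)) (h b) w; lra.
  move=> H; rewrite lef_pV2 ?posrE ?divr_gt0 //.
  by apply: lt_le_trans H; rewrite divr_gt0.
have ck z : cmod z = expR (ln t) -> k @ z --> k z.
  by rewrite tE => zt; apply/cdiff_continuous/dk; rewrite zt.
have := circle_int_bound ck kt; rewrite I0 cmodM cmodR gtr0_norm ?tau_gt0 //.
rewrite mulrC ler_pM2r ?tau_gt0 // k0 cmodV cmodC lef_pV2 ?posrE ?divr_gt0 //.
  by rewrite leNgt wb.
by rewrite cmodC cmod_gt0.
Qed.

(** Mean value inequality, from first order expansions that are uniform along
    the segment: sum them over n equal steps and let n grow. *)
Lemma mean_value_inequality h c K : 0 <= K ->
  (forall b, cmod b <= 4^-1 -> exists2 l, cmod l <= c &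
    forall x, cmod x <= 4^-1 -> cmod (h (b + x) - h b - l * x) <= K * cmod x ^+ 2) ->
  forall a, cmod a <= 4^-1 -> cmod (h a - h 0) <= c * cmod a.
Proof.
move=> K0 hl a a4; apply/ler_addgt0Pl => e e0.
pose n := (Num.bound (K / e)).+1; have n0 : 0 < n%:R :> R by rewrite ltr0n.
have nK : K <= e * n%:R.
  rewrite mulrC -ler_pdivrMr //; apply: le_trans (_ : (Num.bound (K / e))%:R <= _).
    by apply/ltW/archi_boundP; rewrite divr_ge0 // ltW.
  by rewrite ler_nat.
pose v : Cplane R := a * (n%:R^-1)%:C.
have vE : cmod v = cmod a / n%:R.
  by rewrite cmodM cmodR gtr0_norm // invr_gt0.
have v4 : cmod v <= 4^-1.
  apply: le_trans a4; rewrite vE ler_pdivrMr // ler_peMr ?cmod_ge0 //.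
  by rewrite ler1n.
have step k : (k <= n)%N ->
    cmod (h (v * k%:R) - h 0) <= (c * cmod v + K * cmod v ^+ 2) * k%:R.
  elim: k => [_|k IH kn]; first by rewrite !mulr0 subrr cmod0.
  pose b : Cplane R := v * k%:R.
  have b4 : cmod b <= 4^-1.
    rewrite /b cmodM vE (_ : cmod k%:R = k%:R); last first.
      by rewrite -[k%:R]/(k%:R : R[i]) -(rmorph_nat (real_complex R)) cmodR normr_nat.
    apply: le_trans a4; rewrite mulrAC ler_pdivrMr //.
    by rewrite ler_wpM2l ?cmod_ge0 // ler_nat ltnW.
  have [l lc lx] := hl b b4; have {lx} := lx v v4 => lx.
  rewrite -!natr1 [v * _]mulrDr mulr1 -/b.
  have -> : h (b + v) - h 0 = (h (b + v) - h b - l * v) + l * v + (h b - h 0).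
    by ring.
  rewrite mulrDr mulr1 [leRHS]addrC.
  apply: le_trans (cmodD _ _) (lerD _ (IH (ltnW kn))).
  apply: le_trans (cmodD _ _) _; rewrite addrC; apply: lerD => //.
  by rewrite cmodM ler_wpM2r ?cmod_ge0.
have := step n (leqnn n).
have -> : v * n%:R = a.
  rewrite /v -mulrA -(rmorph_nat (real_complex R)) -rmorphM mulVf ?gt_eqF //.
  by rewrite rmorph1 mulr1.
move=> H; apply: le_trans H _; rewrite mulrDl vE addrC.
rewrite -[c * _ * _]mulrA divfK ?gt_eqF // lerD2r.
have -> : K * (cmod a / n%:R) ^+ 2 * n%:R = K * cmod a ^+ 2 / n%:R.
  by field; rewrite gt_eqF.
rewrite ler_pdivrMr // -[leRHS]mulr1; apply: ler_pM => //.
  by rewrite exprn_ge0 // cmod_ge0.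
by rewrite expr_le1 // ?cmod_ge0 //; apply: le_trans a4 _; lra.
Qed.

(** By the mean value inequality, |h'(b)| > c for some b. The second order term at
    b is controlled by B, so |h z - h b| is bounded below on a circle around b whose
    radius depends on B and c only, and minimum_modulus applies. *)
Lemma disc_in_image B c : 0 < c -> exists2 d, 0 < d &
  forall h a, (forall z, cmod z < 1 -> cdiff h z) ->
    (forall z, cmod z < 1 -> cmod (h z) <= B) ->
    cmod a <= 4^-1 -> c <= cmod (h a - h 0) ->
    exists2 b, cmod b < 1 & forall w, cmod (w - h b) < d ->
      exists2 z, cmod z < 1 & h z = w.
Proof.
move=> c0; pose K := Num.max 1 (8 * B).
have K0 : 0 < K by rewrite lt_max ltr01.
pose t := Num.min 4^-1 (c / (2 * K)).
have t0 : 0 < t by rewrite lt_min invr_gt0 ltr0n divr_gt0 // mulr_gt0.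
have t4 : t <= 4^-1 by rewrite ge_min lexx.
have tc : t * (2 * K) <= c by rewrite -ler_pdivlMr ?mulr_gt0 // ge_min lexx orbT.
exists (c * t / 2 / 2); first by rewrite !divr_gt0 // mulr_gt0.
move=> h a dh hB a4 ha.
have expand b : cmod b <= 4^-1 -> exists l, forall x, cmod x <= 4^-1 ->
    cmod (h (b + x) - h b - l * x) <= K * cmod x ^+ 2.
  move=> b4; pose g x : Cplane R := h (b + 1 * x).
  have bx x : cmod x < 3 / 4 -> cmod (b + 1 * x) < 1.
    by move=> x3; rewrite mul1r; apply: le_lt_trans (cmodD _ _) _; lra.
  have dg x : cmod x < 3 / 4 -> cdiff g x.
    by move=> x3; exact: (cdiff_comp (cdiff_affine 1 b x) (dh _ (bx x x3))).
  have r20 : 0 < 2^-1 :> R by rewrite invr_gt0 ltr0n.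
  have r23 : 2^-1 < 3 / 4 :> R by lra.
  have [|||l lB] := @taylor1 _ g _ _ B r20 r23.
  - by move=> x x3; apply/cdiff_continuous/dg.
  - by move=> x /andP[_ x3]; exact: dg.
  - by move=> x x2; apply/hB/bx; rewrite x2.
  exists l => x x4; have x2 : cmod x < 2^-1 by lra.
  have := lB x x2; rewrite /g mulr0 addr0 mul1r => H; apply: le_trans H _.
  have B0 : 0 <= B by apply: le_trans (hB b _); [exact: cmod_ge0 | lra].
  rewrite mulrAC; apply: ler_wpM2r; first by rewrite exprn_ge0 // cmod_ge0.
  apply: (@le_trans _ _ (8 * B)); last by rewrite le_max lexx orbT.
  rewrite mulrC ler_wpM2r // -[8]invrK lef_pV2 ?posrE ?invr_gt0 ?ltr0n //.
    by lra.
  by rewrite mulr_gt0 // subr_gt0.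
have [b b4 [l [lx lc]]] : exists2 b, cmod b <= 4^-1 & exists l,
    (forall x, cmod x <= 4^-1 ->
      cmod (h (b + x) - h b - l * x) <= K * cmod x ^+ 2) /\ c < cmod l.
  apply: contrapT => nb.
  have : cmod (h a - h 0) <= c * cmod a.
    apply: (@mean_value_inequality h c K) => //; first exact: ltW.
    move=> b b4; have [l lx] := expand b b4; exists l => //.
    rewrite leNgt; apply/negP => cl; apply: nb; exists b => //.
    by exists l.
  have : c * cmod a <= c * 4^-1 by rewrite ler_pM2l.
  lra.
have b1 : cmod b < 1 by lra.
exists b => // w wb.
have ct0 : 0 < c * t / 2 by rewrite divr_gt0 // mulr_gt0.
have t34 : t < 3 / 4 by lra.
have bz z : cmod (z - b) < 3 / 4 -> cmod z < 1.
  move=> z3; rewrite -(subrK b z); apply: le_lt_trans (cmodD _ _) _; lra.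
have [||z zb hz] := @minimum_modulus h b (3 / 4) t (c * t / 2) t0 t34 ct0 _ _ w wb.
- by move=> z zb; exact/dh/bz.
- move=> z zb; have z4 : cmod (z - b) <= 4^-1 by rewrite zb.
  have := lx (z - b) z4; rewrite [b + _]addrC subrK zb => H.
  have := cmod_subl (l * (z - b)) (- (h z - h b - l * (z - b))).
  rewrite cmodN cmodM zb opprK.
  have -> : l * (z - b) + (h z - h b - l * (z - b)) = h z - h b by ring.
  have : c * t <= cmod l * t by rewrite ler_pM2r // ltW.
  have : K * t ^+ 2 <= c * t / 2.
    by move: tc; rewrite -(ler_pM2r t0); lra.
  lra.
by exists z => //; exact: bz.
Qed.

End DiscInImage.

(** * Charts and holomorphic maps near a point *)

Section ChartInverse.
Context {R : realType} {T : topologicalType} (c : chart R T) (x0 : T).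
Hypothesis cP : is_chart c.
Implicit Types (x : T) (z : Cplane R).

(** x0 is the value outside the image of the chart. *)
Definition chart_inv z : T := xget x0 [set x | chart_dom c x /\ c x = z].

Lemma chart_invP z : (c @` chart_dom c) z ->
  chart_dom c (chart_inv z) /\ c (chart_inv z) = z.
Proof.
by move=> [x cx xz]; rewrite /chart_inv; case: xgetP => [y _ //|/(_ x)[]].
Qed.

Lemma chart_invK x : chart_dom c x -> chart_inv (c x) = x.
Proof.
move=> cx; have [|d e] := @chart_invP (c x); first by exists x.
by have [_ inj _ _] := cP; apply: inj => //; rewrite inE.
Qed.

Lemma open_chart_image : open (c @` chart_dom c).
Proof. by have [oc _ _ op] := cP; exact: op. Qed.

Lemma chart_continuous x : chart_dom c x -> c @ x --> c x.
Proof.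
have [oc _ cc _] := cP; move: cc; rewrite continuous_open_subspace // => cc cx.
by apply: cc; rewrite inE.
Qed.

Lemma near_chart_dom x : chart_dom c x -> \forall y \near x, chart_dom c y.
Proof. by have [oc _ _ _] := cP; move=> cx; exact: open_nbhs_nbhs. Qed.

Lemma chart_inv_continuous z : (c @` chart_dom c) z ->
  chart_inv @ z --> chart_inv z.
Proof.
move=> cz A; rewrite nbhsE => -[V [oV Vz] VA].
have [dz ez] := chart_invP cz.
have [oc _ _ op] := cP.
have oW : open (c @` (V `&` chart_dom c)).
  by apply: op; [exact: openI | move=> x []].
have Wz : (c @` (V `&` chart_dom c)) z by exists (chart_inv z).
apply: filterS (open_nbhs_nbhs (conj oW Wz)) => _ [x [Vx cx] <-].
by rewrite /= chart_invK //; exact: VA.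
Qed.

Lemma chart_disc x (A : set T) : chart_dom c x -> nbhs x A ->
  exists2 e, 0 < e & forall z, cmod (z - c x) < e ->
    (c @` chart_dom c) z /\ A (chart_inv z).
Proof.
move=> cx Ax; have cz : (c @` chart_dom c) (c x) by exists x.
have h1 : nbhs (c x) (c @` chart_dom c).
  by apply: open_nbhs_nbhs; split => //; exact: open_chart_image.
have h2 : \forall z \near c x, A (chart_inv z).
  by apply: (chart_inv_continuous cz); rewrite chart_invK.
have /nbhsCP[e e0 eA] : \forall z \near c x, (c @` chart_dom c) z /\ A (chart_inv z).
  by apply: filterS2 h1 h2.
by exists e.
Qed.

End ChartInverse.

Lemma chart_inv_default {R : realType} {T : topologicalType} (c : chart R T)
    (x y : T) (z : Cplane R) : is_chart c -> (c @` chart_dom c) z ->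
  chart_inv c x z = chart_inv c y z.
Proof.
move=> [_ inj _ _] cz; have [dx ex] := chart_invP x cz.
have [dy ey] := chart_invP y cz.
by apply: inj; rewrite ?inE // ex ey.
Qed.

Section HolomorphicAt.
Context {R : realType} {M N : riemannSurface R}.
Implicit Types (f : M -> N) (x : M).

Definition holomorphic_at f x := f @ x --> f x /\
  forall c d, atlas M c -> atlas N d -> chart_dom c x -> chart_dom d (f x) ->
    cdiff (d \o f \o chart_inv c x) (c x).

Lemma holomorphic_at_holomorphic f : (forall x, holomorphic_at f x) -> holomorphic f.
Proof.
move=> hf; split=> [x|c d Mc Nd]; first by have [] := hf x.
have [[x0]|nx] := pselect (exists x : M, True); last first.
  exists (fun=> 0); split=> [_ [x _ <-]|x _]; last by case: nx; exists x.
  by case: nx; exists x.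
move=> _; exists (d \o f \o chart_inv c x0); have cP := atlas_chart Mc.
split=> [_ [x [cx dx] <-]|x [cx _]] /=; last by rewrite chart_invK.
apply/cdiffP; have [_ /(_ c d Mc Nd cx dx)] := hf x.
apply: cdiff_near; have cz : (c @` chart_dom c) (c x) by exists x.
apply: filterS (open_nbhs_nbhs (conj (open_chart_image cP) cz)) => z cz' /=.
by rewrite (chart_inv_default x x0 cP cz').
Qed.

(** Riemann's removable singularity theorem, read in charts. *)
Lemma removable_holomorphic_at f p : f @ p --> f p ->
  (forall x, x != p -> holomorphic_at f x) -> holomorphic_at f p.
Proof.
move=> fp hf; split=> // c d Mc Nd cp dp.
have cP := atlas_chart Mc; have dP := atlas_chart Nd.
have [e e0 eD] := chart_disc p cP cp (fp _ (near_chart_dom dP dp)).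
have inv_p z : (c @` chart_dom c) z -> z != c p -> chart_inv c p z != p.
  move=> cz; apply: contra_neq => zp; have [_ <-] := chart_invP p cz.
  by rewrite zp.
have df z : 0 < cmod (z - c p) < e -> cdiff (d \o f \o chart_inv c p) z.
  rewrite cmod_gt0 subr_eq0 => /andP[zp ze]; have [cz dz] := eD z ze.
  have [cx cxz] := chart_invP p cz.
  have [_ /(_ c d Mc Nd cx dz)] := hf _ (inv_p z cz zp).
  rewrite cxz; apply: cdiff_near.
  apply: filterS (open_nbhs_nbhs (conj (open_chart_image cP) cz)) => w cw /=.
  by rewrite (chart_inv_default (chart_inv c p z) p cP cw).
apply: (removable_singularity e0) => // z ze; have [cz dz] := eD z ze.
have [zp|zp] := eqVneq z (c p); last first.
  apply/cdiff_continuous/df; by rewrite ze cmod_gt0 subr_eq0 zp.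
rewrite zp in cz dz *.
have h1 : f @ chart_inv c p (c p) --> f (chart_inv c p (c p)) by rewrite chart_invK.
have h2 := @chart_inv_continuous _ _ c p cP _ cz.
exact: (cvg_comp _ _ (cvg_comp _ _ h2 h1) (chart_continuous dP dz)).
Qed.

(** Exchanges a map of open subsurfaces for a map f of the ambient surfaces, whose
    values outside A are arbitrary. *)
Lemma holomorphic_at_open (A : set M) (B : set N) (oA : open A) (oB : open B)
    (phi : open_surface oA -> open_surface oB) f :
  holomorphic phi ->
  (forall x : open_surface oA, f (set_val x) = set_val (phi x)) ->
  forall x, A x -> holomorphic_at f x.
Proof.
move=> [cphi hphi] fphi x Ax.
pose y : open_surface oA := exist _ x (mem_set Ax).
have yx : set_val y = x by [].
have nA : nbhs x A by exact: open_nbhs_nbhs.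
have fx : f @ x --> f x.
  move=> V; rewrite nbhsE => -[W [oW Wfx] WV].
  have Wy : nbhs (phi y) ((set_val : B -> N) @^-1` W).
    apply: open_nbhs_nbhs; split; first by exists W.
    by rewrite /= -fphi yx.
  have cy := cphi y _ Wy; rewrite /= nbhsE in cy.
  case: cy => W' [[W1 oW1 W1E] W'y] W'W.
  have W1x : W1 x by move: W'y; rewrite -W1E.
  suff H : nbhs x (f @^-1` V) by exact: H.
  apply: filterS2 nA (open_nbhs_nbhs (conj oW1 W1x)) => u Au W1u; rewrite /preimage /=.
  pose v : open_surface oA := exist _ u (mem_set Au).
  have : ((set_val : B -> N) @^-1` W) (phi v).
    by apply: W'W; rewrite -W1E.
  by rewrite /= -fphi; exact: WV.
split=> // c d Mc Nd cx dx; have cP := atlas_chart Mc; have dP := atlas_chart Nd.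
have [||g [hg gE]] := hphi (chart_restr A c) (chart_restr B d).
- by exists c.
- by exists d.
have Dy : (chart_dom (chart_restr A c) `&` phi @^-1` chart_dom (chart_restr B d)) y.
  by split => //=; rewrite -fphi.
have /cdiffP : derivable g (c x) 1 by apply: hg; exists y.
apply: cdiff_near.
have near_x : \forall u \near x, A u /\ chart_dom c u /\ chart_dom d (f u).
  have h1 := fx _ (near_chart_dom dP dx).
  apply: filterS2 nA (filterI (near_chart_dom cP cx) h1) => u Au [cu du].
  by split.
have [e e0 eP] := chart_disc x cP cx near_x.
apply: filterS (near_ballC (c x) e0) => z ze.
have [cz [Az [_ dz]]] := eP z ze; have [cu cuz] := chart_invP x cz.
pose v : open_surface oA := exist _ (chart_inv c x z) (mem_set Az).
have := gE v; rewrite /= -fphi cuz; apply.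
by split => //=; rewrite -fphi.
Qed.

End HolomorphicAt.

(** * Small circles have small images *)

Lemma ultra_fset {T : Type} {I : choiceType} (F : set_system T) (D : {fset I})
    (A : I -> set T) : UltraFilter F ->
  F [set x | exists2 i, i \in D & A i x] -> exists2 i, i \in D & F (A i).
Proof.
move=> FU FA; apply: contrapT => nA.
have FC : F (\bigcap_(i in [set` D]) ~` A i).
  apply: filter_bigI => i iD.
  have [FAi|//] := in_ultra_setVsetC (A i) FU.
  by case: nA; exists i.
by have [x [[i iD Aix] /(_ i iD)]] := filter_ex (filterI FA FC).
Qed.

Lemma ultra_not {T : Type} (F : set_system T) (A : set T) : UltraFilter F ->
  ~ F A -> F (~` A).
Proof. by move=> FU nA; have [] := in_ultra_setVsetC A FU. Qed.

Section ShrinkingCircles.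
Context {R : realType} {N : riemannSurface R}.
Implicit Types (y q : N) (z w : Cplane R) (r s t : R).
Local Open Scope complex_scope.

(** A finite cover of N by coordinate discs whose closures are still contained
    in the charts. *)
Variables (ch : N -> chart R N) (rad : N -> R) (D : {fset N}).
Hypothesis ch_atlas : forall y, atlas N (ch y).
Hypothesis rad_closed : forall y z, cmod (z - ch y y) <= rad y ->
  (ch y @` chart_dom (ch y)) z.

Definition chart_ball y := [set x | chart_dom (ch y) x /\
  cmod (ch y x - ch y y) < rad y].

Hypothesis D_cover : forall x, exists2 y, y \in D & chart_ball y x.

Let chP y : is_chart (ch y). Proof. exact: atlas_chart (ch_atlas y). Qed.

Lemma nbhs_chart_ball y x : chart_ball y x -> nbhs x (chart_ball y).
Proof.
move=> [yx rx]; have rx0 : 0 < rad y - cmod (ch y x - ch y y) by rewrite subr_gt0.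
have /cvgCP /(_ _ rx0) near1 := chart_continuous (chP y) yx.
apply: filterS2 near1 (near_chart_dom (chP y) yx) => u ux yu; split => //.
have := cmod_dist (ch y u) (ch y y) (ch y x); lra.
Qed.

(** G stands for phi in the coordinate log(c - c p), where c is a chart at p. The
    injectivity of phi is used only through G_inj. *)
Variables (G : Cplane R -> N) (L : R).
Hypothesis G_cont : forall z, Re z < L -> G @ z --> G z.
Hypothesis G_diff : forall y z, Re z < L -> chart_dom (ch y) (G z) ->
  cdiff (ch y \o G) z.
Hypothesis G_inj : forall z w, Re z < L -> Re w < L -> G z = G w -> Re z = Re w.

Definition small z r := exists2 y, y \in D &
  forall w, cmod (w - z) < r -> chart_ball y (G w).

(** Take two indices near a cluster point; they can be chosen distinct since F
    contains the tails. *)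
Lemma cluster_pair {F : set_system nat} {FF : ProperFilter F} (E : set nat)
    (b : nat -> Cplane R) r d : \oo `<=` F -> F E -> 0 < d ->
  (forall k, E k -> cmod (b k) <= r) ->
  exists k l, [/\ E k, E l, k <> l & cmod (b l - b k) < d].
Proof.
move=> ooF FE d0 br.
have Fb : F [set k | cmod (b k - 0) <= r].
  by apply: filterS FE => k /br; rewrite /= subr0.
have [x [_ cx]] := @compact_disc R 0 r (b @ F) _ Fb.
have d20 : 0 < d / 2 by rewrite divr_gt0.
have get A : F A -> exists2 k, A k & cmod (b k - x) < d / 2.
  move=> FA; have FbA : F (b @^-1` (b @` A)) by apply: filterS FA => k Ak; exists k.
  have [_ [[k Ak <-] bk]] := cx _ _ FbA (near_ballC x d20).
  by exists k.
have [k Ek bk] := get E FE.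
have Fk : F [set l | (k < l)%N] by apply/ooF/nbhs_infty_gt.
have [l [El kl] bl] := get _ (filterI FE Fk).
exists k, l; split => //; first by move=> kl'; rewrite kl' /= ltnn in kl.
have := cmod_dist (b l) (b k) x; rewrite [cmod (x - _)]cmodC; lra.
Qed.

Section TwoPoints.
Variables (F : set_system nat).
Hypotheses (FU : UltraFilter F) (ooF : \oo `<=` F).
Variables (eta xi : nat -> Cplane R) (rho : nat -> R) (q : N).
Hypothesis rho_gt0 : forall k, 0 < rho k.
Hypothesis xi_near : forall k, cmod (xi k - eta k) <= rho k / 4.
Hypothesis eta_left : forall k, Re (eta k) + rho k < L.
Hypothesis eta_small : forall k, small (eta k) (rho k).
Hypothesis eta_apart : forall k l z w, k <> l ->
  cmod (z - eta k) < rho k -> cmod (w - eta l) < rho l -> Re z <> Re w.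

Let disc_left k z : cmod (z - eta k) < rho k -> Re z < L.
Proof.
move=> zk; apply: lt_trans (eta_left k).
have := le_lt_trans (Re_le_cmod _) zk; case: (z) (eta k) => p1 p2 [p3 p4] /=.
by rewrite ltr_norml; lra.
Qed.

(** The images of the discs of center eta k are disjoint. If xi k did not follow
    eta k, infinitely many of them would contain discs of a fixed radius inside
    one coordinate disc. *)
Lemma two_points : G \o eta @ F --> q -> G \o xi @ F --> q.
Proof.
move=> etaq.
have [y yD Fy] := @ultra_fset _ _ F D (fun y => [set k |
  forall w, cmod (w - eta k) < rho k -> chart_ball y (G w)]) FU
  (filterS (fun k _ => eta_small k) filterT).
pose c := ch y; have cP : is_chart c := chP y.
pose h k x := c (G (eta k + (rho k)%:C * x)).
have eta_disc k x : cmod x < 1 -> cmod (eta k + (rho k)%:C * x - eta k) < rho k.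
  move=> x1; rewrite addrC addKr cmodM cmodR gtr0_norm //.
  by rewrite gtr_pMr.
pose E0 := [set k | forall w, cmod (w - eta k) < rho k -> chart_ball y (G w)].
have dh k : E0 k -> forall x, cmod x < 1 -> cdiff (h k) x.
  move=> Ek x x1; have wk := eta_disc k x x1; have [yw _] := Ek _ wk.
  have dG := G_diff (disc_left wk) yw.
  exact: (cdiff_comp (cdiff_affine (rho k)%:C (eta k) x) dG).
pose B := rad y + cmod (c y).
have hB k : E0 k -> forall x, cmod x < 1 -> cmod (h k x) <= B.
  move=> Ek x x1; have [_ yw] := Ek _ (eta_disc k x x1).
  have := cmodD (h k x - c y) (c y); rewrite subrK => H.
  by apply: le_trans H _; rewrite lerD2r ltW.
pose a k := (xi k - eta k) / (rho k)%:C.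
have rho0 k : (rho k)%:C != 0 :> R[i] by rewrite eq_complex /= gt_eqF // rho_gt0.
have a4 k : cmod (a k) <= 4^-1.
  by rewrite cmod_div cmodR gtr0_norm // ler_pdivrMr // mulrC.
have h0 k : h k 0 = c (G (eta k)) by rewrite /h mulr0 addr0.
have ha k : h k (a k) = c (G (xi k)).
  by rewrite /h /a mulrC divfK // addrC subrK.
have close e : 0 < e -> F [set k | cmod (c (G (xi k)) - c (G (eta k))) < e].
  move=> e0; apply: contrapT => /(ultra_not FU) nF.
  have [d d0 dP] := disc_in_image B e0.
  pose E := E0 `&` ~` [set k | cmod (c (G (xi k)) - c (G (eta k))) < e].
  have FE : F E by exact: filterI.
  have /choice[b bP] : forall k, exists b, E k -> cmod b < 1 /\
      forall w, cmod (w - h k b) < d -> exists2 z, cmod z < 1 & h k z = w.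
    move=> k; have [Ek|nE] := pselect (E k); last by exists 0.
    have [E0k /= /negP] := Ek; rewrite -leNgt => ek.
    have [|b b1 bd] := dP _ _ (dh k E0k) (hB k E0k) (a4 k).
      by rewrite h0 ha.
    by exists b.
  have bB k : E k -> cmod (h k (b k)) <= B.
    by move=> Ek; have [b1 _] := bP k Ek; exact: hB Ek.1 _ b1.
  have [k [l [Ek El kl dkl]]] := cluster_pair ooF FE d0 bB.
  have [_ /(_ _ dkl)[z z1 hz]] := bP k Ek; have [bl1 _] := bP l El.
  have zk := eta_disc k z z1; have wl := eta_disc l (b l) bl1.
  apply: (eta_apart kl zk wl); apply: G_inj; [exact: disc_left zk|exact: disc_left wl|].
  have [yz _] := Ek.1 _ zk; have [yw _] := El.1 _ wl.
  have [_ inj _ _] := cP; apply: inj; rewrite ?inE //; exact: hz.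
have eta0 k : cmod (eta k - eta k) < rho k by rewrite subrr cmod0.
have xi0 k : cmod (xi k - eta k) < rho k.
  by apply: le_lt_trans (xi_near k) _; rewrite ltr_pdivrMr // ltr_pMr // ltr1n.
(* the limit q lies in the closed coordinate disc *)
have yq : chart_dom c q.
  have Fr : F [set k | cmod (c (G (eta k)) - c y) <= rad y].
    by apply: filterS Fy => k Ek; have [_ /ltW] := Ek _ (eta0 k).
  have [u [ur cu]] := @compact_disc R (c y) (rad y) (c \o G \o eta @ F) _ Fr.
  have ui := rad_closed ur; have [yu cuu] := chart_invP q ui.
  suff <- : chart_inv c q u = q by [].
  apply: (@rs_hausdorff _ N) => V W Vu Wq.
  have near_u : \forall z \near u, V (chart_inv c q z).
    exact: (@chart_inv_continuous _ _ c q cP u ui V Vu).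
  have FW : F [set k | W (G (eta k)) /\ E0 k].
    by apply: filterI Fy; exact: etaq.
  have FWc : F ((c \o G \o eta) @^-1`
      ((c \o G \o eta) @` [set k | W (G (eta k)) /\ E0 k])).
    by apply: filterS FW => k Wk; exists k.
  have [_ [[k [Wk Ek] <-] Vk]] := cu _ _ FWc near_u.
  exists (G (eta k)); split => //; have [yk _] := Ek _ (eta0 k).
  by move: Vk; rewrite /= chart_invK.
have cq : (c @` chart_dom c) (c q) by exists q.
have cxi : c \o G \o xi @ F --> c q.
  apply/cvgCP => e e0; have e20 : 0 < e / 2 by rewrite divr_gt0.
  have /cvgCP /(_ _ e20) H := cvg_comp _ _ etaq (chart_continuous cP yq).
  apply: filterS2 (close _ e20) H => k /= h1 h2.
  have := cmod_dist (c (G (xi k))) (c q) (c (G (eta k))); lra.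
move=> V Vq.
have near_cq : \forall z \near c q, V (chart_inv c q z).
  by apply: (@chart_inv_continuous _ _ c q cP (c q) cq); rewrite chart_invK.
have Fcq : F [set k | V (chart_inv c q (c (G (xi k))))] by exact: cxi near_cq.
suff FV : F [set k | V (G (xi k))] by exact: FV.
apply: filterS2 Fcq Fy => k /= Vk Ek.
by have [yk _] := Ek _ (xi0 k); move: Vk; rewrite chart_invK.
Qed.

End TwoPoints.

Section Chains.
Variables (F : set_system nat).
Hypotheses (FU : UltraFilter F) (ooF : \oo `<=` F).

(** Apply two_points along n + 1 equal steps from zeta k to xi k. The distance 16
    between vertical lines leaves room for paths of length 7 and discs of
    radius 1. *)
Lemma chain (zeta xi : nat -> Cplane R) (rho : nat -> R) (q : N) n :
  (forall k, 0 < rho k <= 1) ->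
  (forall k, cmod (xi k - zeta k) <= 7) ->
  (forall k, cmod (xi k - zeta k) <= n.+1%:R * (rho k / 4)) ->
  (forall k, Re (zeta k) + 8 < L) ->
  (forall k l, (k < l)%N -> Re (zeta l) + 16 <= Re (zeta k)) ->
  (forall k z, cmod (z - zeta k) <= cmod (xi k - zeta k) -> small z (rho k)) ->
  G \o zeta @ F --> q -> G \o xi @ F --> q.
Proof.
move=> rho01 xi7 xin zetaL apart zsmall zetaq.
have n0 : n.+1%:R != 0 :> R by rewrite pnatr_eq0.
pose p i k : Cplane R := zeta k + (i%:R / n.+1%:R)%:C * (xi k - zeta k).
have p_near i k : (i <= n.+1)%N -> cmod (p i k - zeta k) <= cmod (xi k - zeta k).
  move=> i_n; rewrite /p addrC addKr cmodM cmodR ger0_norm ?divr_ge0 //.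
  by rewrite ler_piMl ?cmod_ge0 // ler_pdivrMr ?ltr0n // mul1r ler_nat.
have p_Re i k z : (i <= n.+1)%N -> cmod (z - p i k) < rho k ->
    Re (zeta k) - 8 < Re z < Re (zeta k) + 8.
  move=> /(p_near _ k) pk zk; have /andP[_ rho1] := rho01 k.
  have zz : cmod (z - zeta k) < 8.
    apply: le_lt_trans (cmod_dist z (zeta k) (p i k)) _; have := xi7 k; lra.
  have := le_lt_trans (Re_le_cmod _) zz.
  by case: (z) (zeta k) => [z1 z2] [u1 u2] /=; rewrite ltr_norml; lra.
have step i : (i <= n.+1)%N -> G \o p i @ F --> q.
  elim: i => [_|i IH i_n].
    suff -> : p 0%N = zeta by [].
    by apply/funext => k; rewrite /p mul0r mul0r addr0.
  have i_le : (i <= n.+1)%N by exact: ltnW.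
  apply: (@two_points F FU ooF (p i) (p i.+1) rho q _ _ _ _ _ (IH i_le)).
  - by move=> k; case/andP: (rho01 k).
  - move=> k; have -> : p i.+1 k - p i k = (n.+1%:R^-1)%:C * (xi k - zeta k).
      rewrite /p -[i.+1%:R]natr1 mulrDl mul1r rmorphD /=.
      set u := (i%:R / _)%:C; set v := (_^-1)%:C; ring.
    rewrite cmodM cmodR ger0_norm ?invr_ge0 // mulrC ler_pdivrMr ?ltr0n //.
    by rewrite mulrC.
  - move=> k; have pk := p_near i k i_le; have /andP[_ rho1] := rho01 k.
    have := le_trans (Re_le_cmod _) (le_trans pk (xi7 k)); have := zetaL k.
    by case: (p i k) (zeta k) => [z1 z2] [u1 u2] /=; rewrite ler_norml; lra.
  - by move=> k; apply: zsmall; exact: p_near.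
  - move=> k l z w kl /(p_Re _ _ _ i_le) zk /(p_Re _ _ _ i_le) wl zw.
    have [|] := ltnP k l; first by move=> /apart; lra.
    rewrite leq_eqVlt => /predU1P[lk|/apart]; last lra.
    by apply: kl; rewrite lk.
suff -> : xi = p n.+1 by exact: step.
by apply/funext => k; rewrite /p divff // mul1r addrC subrK.
Qed.

End Chains.

Lemma last_true (P : nat -> Prop) n : P 0%N -> ~ P n ->
  exists k, P k /\ ~ P k.+1.
Proof.
elim: n => [//|n IH] P0 Pn; have [Pn'|nPn] := pselect (P n); last exact: IH.
by exists n.
Qed.

(** A cluster point of b has a neighborhood that G maps into one coordinate
    disc. *)
Lemma not_always_small z (b : nat -> Cplane R) (r : R) : Re z + 1 < L ->
  (forall n, cmod (b n - z) <= 1) ->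
  exists n, small (b n) (r / 2 ^+ n).
Proof.
move=> zL bz; apply: contrapT => nb.
have boo : \oo [set n | cmod (b n - z) <= 1] by apply: filterS filterT => n _; exact: bz.
have [x [xz cx]] := @compact_disc R z 1 (b @ \oo) _ boo.
have xL : Re x < L.
  have := le_trans (Re_le_cmod _) xz.
  by case: (x) (z) zL => [x1 x2] [z1 z2] /=; rewrite ler_norml; lra.
have [y yD yx] := D_cover (G x).
have /nbhsCP[e e0 ey] : \forall w \near x, chart_ball y (G w).
  exact: (G_cont xL (nbhs_chart_ball yx)).
have e20 : 0 < e / 2 by rewrite divr_gt0.
have [m rm] := halving_lt r e20.
have Fm : \oo (b @^-1` (b @` [set n | (m <= n)%N])).
  by apply: filterS (nbhs_infty_ge m) => n mn; exists n.
have [_ [[n mn <-] bn]] := cx _ _ Fm (near_ballC x e20).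
apply: nb; exists n; exists y => // w wb; apply: ey.
have r_le : r / 2 ^+ n < e / 2.
  have [r0|r0] := leP r 0.
    apply: le_lt_trans e20; by rewrite mulr_le0_ge0 // invr_ge0 exprn_ge0.
  apply: le_lt_trans rm; rewrite ler_pM2l // lef_pV2 ?posrE ?exprn_gt0 //.
  by rewrite ler_weXn2l // ler1n.
have := cmod_dist w x (b n); lra.
Qed.

(** Zooming in at a point where G oscillates: as long as some point within the
    current scale oscillates at half of the scale, move to it. The moves have total
    length less than 1/2, and by compactness they stop. *)
Lemma point_picking z0 : Re z0 + 1 < L -> ~ small z0 4^-1 ->
  exists zr : Cplane R * R, [/\ 0 < zr.2 <= 4^-1, cmod (zr.1 - z0) <= 2^-1,
    ~ small zr.1 zr.2 &
    forall w, cmod (w - zr.1) <= zr.2 -> small w (zr.2 / 2)].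
Proof.
move=> z0L nsmall; pose r n : R := 4^-1 / 2 ^+ n.
have rS n : r n.+1 = r n / 2 by rewrite /r exprS invfM [2^-1 * _]mulrC mulrA.
have r0 n : 0 < r n by rewrite divr_gt0 ?invr_gt0 ?exprn_gt0 ?ltr0n.
have r00 : r 0%N = 4^-1 by rewrite /r expr0 divr1.
pose P n := exists2 z, cmod (z - z0) <= 2^-1 - 2 * r n & ~ small z (r n).
have P0 : P 0%N by exists z0; rewrite r00 // subrr cmod0; lra.
have [m nPm] : exists m, ~ P m.
  apply: contrapT => aP.
  have /choice[b bP] : forall n, exists z, cmod (z - z0) <= 1 /\ ~ small z (r n).
    move=> n; have [z zn nz] : P n by apply: contrapT => nP; apply: aP; exists n.
    by exists z; split => //; have := r0 n; lra.
  have [n bn] := @not_always_small z0 b 4^-1 z0L (fun n => (bP n).1).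
  by have [_] := bP n; apply.
have [n [[z zn nz] nP]] := last_true P0 nPm.
exists (z, r n); split => //=.
- rewrite r0 -r00 /r ler_pM2l ?invr_gt0 ?ltr0n // lef_pV2 ?posrE ?exprn_gt0 //.
  by rewrite expr0 exprn_ege1 // ler1n.
- by have := r0 n; lra.
- move=> w wz; rewrite -rS; apply: contrapT => nw; apply: nP; exists w => //.
  apply: le_trans (cmod_dist w z0 z) _; rewrite rS; lra.
Qed.

Lemma ultra_cluster_cvg {T : topologicalType} {I : Type} (F : set_system I)
    (f : I -> T) x : UltraFilter F -> cluster (f @ F) x -> f @ F --> x.
Proof.
move=> FU cx V Vx; apply: contrapT => /(ultra_not FU) nV.
by have [y [nVy Vy]] := cx (~` V) V nV Vx.
Qed.

Hypothesis N_compact : compact [set: N].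

Lemma compact_ultra_lim (F : set_system nat) (u : nat -> N) : UltraFilter F ->
  exists q, u @ F --> q.
Proof.
move=> FU; have FT : (u @ F) [set: N] by exact: filterT.
have [q [_ cq]] := @N_compact (u @ F) _ FT.
by exists q; exact: ultra_cluster_cvg.
Qed.

(** If G oscillated at scale 1/4 arbitrarily far to the left, zooming in would give
    discs that are far apart and on which G oscillates, but at half of whose radius
    G is small everywhere; chain then forces the images of these discs to shrink to
    a point. *)
Lemma eventually_small : exists s, forall z, Re z < s -> small z 4^-1.
Proof.
apply: contrapT => ns.
have /choice[Z ZP] : forall s, exists z, Re z < s /\ ~ small z 4^-1.
  move=> s; apply: contrapT => nz; apply: ns; exists s => z zs.
  by apply: contrapT => nzs; apply: nz; exists z.
pose z0 := fix z0 k := if k is j.+1 then Z (Re (z0 j) - 20) else Z (L - 20).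
have z0S k : Re (z0 k.+1) < Re (z0 k) - 20 by have [] := ZP (Re (z0 k) - 20).
have z0_apart k l : (k < l)%N -> Re (z0 l) < Re (z0 k) - 20.
  elim: l => [//|l IH]; rewrite ltnS leq_eqVlt => /predU1P[->//|/IH].
  have := z0S l; lra.
have z00 : Re (z0 0%N) < L - 20 by have [] := ZP (L - 20).
have z0L k : Re (z0 k) < L - 20.
  by case: k => [//|k]; have := z0_apart 0%N k.+1 isT; lra.
have z0n k : ~ small (z0 k) 4^-1.
  by case: k => [|k]; [have [] := ZP (L - 20)|have [] := ZP (Re (z0 k) - 20)].
have /choice[zr zrP] : forall k, exists zr : Cplane R * R,
    [/\ 0 < zr.2 <= 4^-1, cmod (zr.1 - z0 k) <= 2^-1,
    ~ small zr.1 zr.2 &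
    forall w, cmod (w - zr.1) <= zr.2 -> small w (zr.2 / 2)].
  by move=> k; apply: point_picking (z0n k); have := z0L k; lra.
have [F [FU ooF]] := @ultraFilterLemma nat (\oo) _.
have [q zq] := compact_ultra_lim (G \o (fun k => (zr k).1)) FU.
have [y yD yq] := D_cover q.
have /choice[xi xiP] : forall k, exists w,
    cmod (w - (zr k).1) < (zr k).2 /\ ~ chart_ball y (G w).
  move=> k; have [_ _ nk _] := zrP k; apply: contrapT => nw; apply: nk.
  by exists y => // w wk; apply: contrapT => nyw; apply: nw; exists w.
have zr_Re k : Re (z0 k) - 1 <= Re (zr k).1 <= Re (z0 k) + 1.
  have [_ zk _ _] := zrP k; have := le_trans (Re_le_cmod _) zk.
  by case: ((zr k).1) (z0 k) => [z1 z2] [u1 u2] /=; rewrite ler_norml; lra.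
have xiq : G \o xi @ F --> q.
  apply: (@chain F FU ooF (fun k => (zr k).1) xi (fun k => (zr k).2 / 2) q 7
    _ _ _ _ _ _ zq) => k.
  - by have [/andP[? ?] _ _ _] := zrP k; apply/andP; split; lra.
  - by have [/andP[? ?] _ _ _] := zrP k; have [? _] := xiP k; lra.
  - by have [? _] := xiP k; lra.
  - by have := zr_Re k; have := z0L k; lra.
  - move=> l kl; have := zr_Re k; have := zr_Re l.
    by have := z0_apart k l kl; lra.
  - move=> z zk; have [_ _ _] := zrP k; apply.
    by apply: le_trans zk _; have [/ltW] := xiP k.
have Fy : F [set k | chart_ball y (G (xi k))] by exact: xiq (nbhs_chart_ball yq).
by have [k yk] := filter_ex Fy; have [_] := xiP k; apply.
Qed.

(** Now chain applies, at the fixed scale 1/4, along whole vertical segments of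
    length 2 pi. *)
Lemma small_circles : exists q, forall V, nbhs q V -> forall s, exists s',
  [/\ s' < s, s' < L & forall t, `|t| <= pi -> V (G (s' +i* t))].
Proof.
have [s0 s0P] := eventually_small.
pose s1 := Num.min s0 L - 20.
have s1L : s1 <= L - 20 by rewrite lerD2r ge_min lexx orbT.
have s1s0 : s1 <= s0 - 20 by rewrite lerD2r ge_min lexx.
pose s k : R := s1 - 20 * k%:R.
have s_le k : s k <= s1 by rewrite gerBl mulr_ge0.
pose zeta k : Cplane R := s k +i* 0.
have [F [FU ooF]] := @ultraFilterLemma nat (\oo) _.
have [q zq] := compact_ultra_lim (G \o zeta) FU.
exists q => V Vq s'.
suff FV : F [set k | forall t, `|t| <= pi -> V (G (s k +i* t))].
  have Fs : F [set k | s k < s'].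
    apply: ooF; exists (Num.bound `|s1 - s'|) => // k /= bk.
    have : `|s1 - s'| < k%:R.
      by apply: lt_le_trans (archi_boundP (normr_ge0 _)) _; rewrite ler_nat.
    by rewrite ltr_norml /s; have : 0 <= k%:R :> R by []; lra.
  have [k [Vk ks]] := filter_ex (filterI FV Fs).
  by exists (s k); split => //; have := s_le k; lra.
apply: contrapT => /(ultra_not FU) nV.
have /choice[th thP] : forall k, exists t, `|t| <= pi /\
    (~ (forall t, `|t| <= pi -> V (G (s k +i* t))) -> ~ V (G (s k +i* t))).
  move=> k; have [|nk] := pselect (forall t, `|t| <= pi -> V (G (s k +i* t))).
    by exists 0; split => //; rewrite normr0 pi_ge0.
  apply: contrapT => nt; apply: nk => t tpi; apply: contrapT => nVt.
  by apply: nt; exists t.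
pose xi k : Cplane R := s k +i* th k.
have xiE k : cmod (xi k - zeta k) = `|th k|.
  rewrite /cmod /xi /zeta /= subrr subr0 expr0n add0r sqrtr_sqr //.
have th4 k : `|th k| <= 4.
  have [tk _] := thP k; apply: le_trans tk _.
  have := @pihalf_02 R; lra.
have xiq : G \o xi @ F --> q.
  apply: (@chain F FU ooF zeta xi (fun=> 4^-1) q 63 _ _ _ _ _ _ zq) => k.
  - by apply/andP; split; lra.
  - by rewrite xiE; have := th4 k; lra.
  - by rewrite xiE; have := th4 k; lra.
  - by rewrite /= ; have := s_le k; lra.
  - move=> l kl /=; rewrite /s.
    have : (k.+1)%:R <= l%:R :> R by rewrite ler_nat.
    by rewrite -natr1; lra.
  - move=> z; rewrite xiE => zk; apply: s0P.
    have := le_trans (Re_le_cmod _) (le_trans zk (th4 k)); have := s_le k.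
    by case: (z) => [z1 z2] /=; rewrite ler_norml; lra.
have Fxi : F [set k | V (G (xi k))] by exact: xiq.
have [k [Vk nVk]] := filter_ex (filterI Fxi nV).
by have [_ /(_ nVk)] := thP k; apply.
Qed.

End ShrinkingCircles.

(** * The image of a punctured neighborhood *)

(** Finite covers by neighborhoods, on a space without a distinguished point. *)
Lemma compact_fset_cover {T : topologicalType} (B : T -> set T) :
  compact [set: T] -> (forall x, nbhs x (B x)) ->
  exists D : {fset T}, forall x, exists2 y, y \in D & B y x.
Proof.
move=> /compact_near_coveringP cT Bx.
pose above (D : {fset T}) := [set E : {fset T} | {subset D <= E}].
pose F := filter_from [set: {fset T}] above.
have FF : ProperFilter F.
  apply: filter_from_proper => [|D _]; last by exists D => x.
  apply: filter_from_filter => [|D E _ _]; first by exists fset0.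
  exists (D `|` E)%fset => // G DEG.
  by split=> x xD; apply: DEG; rewrite inE xD ?orbT.
pose P (D : {fset T}) x := exists2 y, y \in D & B y x.
have [|D _ /(_ D (fun _ h => h)) DP] := cT _ F P _; last by exists D => x; exact: DP.
move=> x _; exists (B x, [set D : {fset T} | x \in D]) => /=.
  split; first exact: Bx.
  by exists [fset x]%fset => // D; apply; rewrite inE.
by move=> [y D] /= [xy xD]; exists x.
Qed.

Lemma finite_chart_cover {R : realType} (N : riemannSurface R) :
  compact [set: N] -> exists (ch : N -> chart R N) (rad : N -> R) (D : {fset N}),
    [/\ forall y, atlas N (ch y),
      forall y z, cmod (z - ch y y) <= rad y -> (ch y @` chart_dom (ch y)) z &
      forall x, exists2 y, y \in D & chart_ball ch rad y x].
Proof.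
move=> cN.
have /choice[cr crP] : forall y : N, exists cr : chart R N * R,
    [/\ atlas N cr.1, chart_dom cr.1 y, 0 < cr.2 &
    forall z, cmod (z - cr.1 y) <= cr.2 -> (cr.1 @` chart_dom cr.1) z].
  move=> y; have [c Nc cy] := atlas_cover y.
  have [e e0 ez] := chart_disc y (atlas_chart Nc) cy filterT.
  exists (c, e / 2); split => //=; first by rewrite divr_gt0.
  move=> z ze; have [] // := ez z.
  by apply: le_lt_trans ze _; rewrite ltr_pdivrMr // ltr_pMr // ltr1n.
pose ch y := (cr y).1; pose rad y := (cr y).2.
have ch_atlas y : atlas N (ch y) by have [] := crP y.
have [|D DN] := @compact_fset_cover _ (chart_ball ch rad) cN _.
  move=> x; apply: (nbhs_chart_ball ch_atlas).
  have [_ cx r0 _] := crP x; split => //.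
  by rewrite subrr cmod0.
exists ch, rad, D; split => // y z; by have [_ _ _] := crP y; apply.
Qed.

Section Puncture.
Context {R : realType} {M N : riemannSurface R}.
Implicit Types (x : M) (y : N) (z w : Cplane R) (r e : R).
Local Open Scope complex_scope.

Hypotheses (M_compact : compact [set: M]) (N_compact : compact [set: N]).
Hypothesis N_connected : connected [set: N].
(** f and g extend phi and its inverse by arbitrary values at p and outside U. *)
Variables (p : M) (U : set N) (f : M -> N) (g : N -> M).
Hypothesis U_open : open U.
Hypothesis fU : forall x, x != p -> U (f x).
Hypothesis fK : forall x, x != p -> g (f x) = x.
Hypothesis gp : forall y, U y -> g y != p.
Hypothesis gK : forall y, U y -> f (g y) = y.
Hypothesis f_holo : forall x, x != p -> holomorphic_at f x.
Hypothesis g_cont : forall y, U y -> g @ y --> g y.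

Variables (c : chart R M) (rho : R).
Hypotheses (cM : atlas M c) (cp : chart_dom c p) (rho_gt0 : 0 < rho).
Hypothesis rho_disc : forall z, cmod (z - c p) < rho -> (c @` chart_dom c) z.

Let cP : is_chart c. Proof. exact: atlas_chart cM. Qed.

Let kappa w := chart_inv c p (c p + w).

Let kappaP w : cmod w < rho -> chart_dom c (kappa w) /\ c (kappa w) = c p + w.
Proof. by move=> wr; apply/chart_invP/rho_disc; rewrite addrC addKr. Qed.

Let kappa_neq w : cmod w < rho -> w != 0 -> kappa w != p.
Proof.
move=> wr; apply: contra_neq => kw; have [_] := kappaP wr; rewrite kw => e.
by apply: (addrI (c p)); rewrite addr0 -e.
Qed.

Let kappa_inj w w' : cmod w < rho -> cmod w' < rho -> kappa w = kappa w' -> w = w'.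
Proof.
move=> wr wr' kk; have [_ e] := kappaP wr; have [_ e'] := kappaP wr'.
by apply: (addrI (c p)); rewrite -e -e' kk.
Qed.

Let f_inj x x' : x != p -> x' != p -> f x = f x' -> x = x'.
Proof. by move=> xp xp' ff; rewrite -(fK xp) -(fK xp') ff. Qed.

(** In the coordinate log(c - c p) of the punctured disc the circles become
    vertical segments. *)
Lemma puncture_circles : exists q : N, forall V, nbhs q V -> forall e, 0 < e ->
  exists r, [/\ 0 < r, r < e, r < rho &
    forall x, chart_dom c x -> cmod (c x - c p) = r -> V (f x)].
Proof.
have [ch [rad [D [chN radP DP]]]] := finite_chart_cover N_compact.
pose G z := f (kappa (cexp z)); pose L := ln rho.
have LE z : Re z < L -> cmod (cexp z) < rho.
  by move=> zL; rewrite cmod_cexp -[rho]lnK ?posrE // ltr_expR.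
have kp z : Re z < L -> kappa (cexp z) != p.
  by move=> zL; apply: kappa_neq (LE z zL) (cexp_neq0 z).
have ce z : cdiff (fun w => c p + cexp w) z.
  exact: (cdiffD (cdiff_cst (c p) z) (@cdiff_cexp _ z)).
have ci z : Re z < L -> (c @` chart_dom c) (c p + cexp z).
  by move=> zL; apply: rho_disc; rewrite addrC addKr; exact: LE.
have G_cont z : Re z < L -> G @ z --> G z.
  move=> zL; have [h1 _] := f_holo (kp z zL).
  have h2 := @chart_inv_continuous _ _ c p cP _ (ci z zL).
  exact: (cvg_comp _ _ (cvg_comp _ _ (cdiff_continuous (ce z)) h2) h1).
have G_diff y z : Re z < L -> chart_dom (ch y) (G z) -> cdiff (ch y \o G) z.
  move=> zL yz; have [cx cxz] := kappaP (LE z zL).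
  have [_ /(_ c (ch y) cM (chN y) cx yz)] := f_holo (kp z zL).
  rewrite cxz => /(cdiff_comp (ce z)); apply: cdiff_near.
  have zL0 : 0 < L - Re z by rewrite subr_gt0.
  apply: filterS (near_ballC z zL0) => w wz /=.
  rewrite /G /kappa (chart_inv_default _ p cP) //; apply: ci.
  have := le_lt_trans (Re_le_cmod _) wz.
  by case: (w) (z) => [w1 w2] [z1 z2] /=; rewrite ltr_norml; lra.
have G_inj z w : Re z < L -> Re w < L -> G z = G w -> Re z = Re w.
  move=> zL wL /(f_inj (kp z zL) (kp w wL)) /(kappa_inj (LE z zL) (LE w wL)) zw.
  by apply: expR_inj; rewrite -!cmod_cexp zw.
have [q qP] := small_circles chN radP DP G_cont G_diff G_inj N_compact.
exists q => V Vq e e0; have [s [se sL Vs]] := qP V Vq (ln e).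
have sE : expR s < e by rewrite -[e]lnK ?posrE // ltr_expR.
have sR : expR s < rho by rewrite -[rho]lnK ?posrE // ltr_expR.
exists (expR s); split => //; first exact: expR_gt0.
move=> x cx /cexp_polar[t tpi ts]; have := Vs t tpi.
by rewrite /G -ts /kappa addrC subrK chart_invK.
Qed.

Lemma open_chart_disc {T : riemannSurface R} (d : chart R T) (z : Cplane R) r :
  is_chart d -> open [set x | chart_dom d x /\ cmod (d x - z) < r].
Proof.
move=> dP; rewrite openE => x [dx xr].
have xr0 : 0 < r - cmod (d x - z) by rewrite subr_gt0.
have /cvgCP /(_ _ xr0) near1 := chart_continuous dP dx.
apply: filterS2 near1 (near_chart_dom dP dx) => u ux du; split => //.
have := cmod_dist (d u) z (d x); lra.
Qed.

Lemma closed_chart_disc {T : riemannSurface R} (d : chart R T) (x0 : T) r :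
  is_chart d -> (forall z, cmod (z - d x0) <= r -> (d @` chart_dom d) z) ->
  closed [set x | chart_dom d x /\ cmod (d x - d x0) <= r].
Proof.
move=> dP dr; apply: compact_closed; first exact: rs_hausdorff.
rewrite (_ : mkset _ = chart_inv d x0 @` [set z | cmod (z - d x0) <= r]).
  apply: continuous_compact; last exact: compact_disc.
  apply: continuous_in_subspaceT => z; rewrite inE => /dr dz.
  exact: (@chart_inv_continuous _ _ d x0 dP _ dz).
rewrite eqEsubset; split=> [x [dx xr]|_ [z zr <-]] /=.
  by exists (d x) => //; rewrite chart_invK.
by have [dz ez] := chart_invP x0 (dr z zr); rewrite ez.
Qed.

(** Let B be a coordinate disc around q that misses some point y0 of the image of
    the exterior, and choose a circle around p that is mapped into B. The boundary
    circle S of B is connected and disjoint from the image of the chosen circle, so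
    S lies inside or outside the image E of the exterior of that circle. Inside, the
    union of E and B is open and closed, hence all of N. Outside, the part of E
    outside of B would be open and closed, although it contains y0 and not q. *)
Lemma complement_exterior (q : N) (V : set N) : nbhs q V ->
  (forall W, nbhs q W -> forall e, 0 < e -> exists r, [/\ 0 < r, r < e, r < rho &
    forall x, chart_dom c x -> cmod (c x - c p) = r -> W (f x)]) ->
  exists2 r, 0 < r <= rho &
    forall y, ~ (exists2 x, ~ (chart_dom c x /\ cmod (c x - c p) <= r) & f x = y) ->
    V y.
Proof.
move=> Vq circles.
(* a point outside the disc of radius rho / 2 whose image is not q *)
have [x0 x0out fx0] : exists2 x0, (forall r, r <= rho / 2 ->
    ~ (chart_dom c x0 /\ cmod (c x0 - c p) <= r)) & f x0 != q.
  pose w : Cplane R := (3 / 4 * rho)%:C.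
  have w34 : cmod w = 3 / 4 * rho by rewrite cmodR gtr0_norm // mulr_gt0 ?divr_gt0.
  have wr : cmod w < rho by rewrite w34; move: rho_gt0; lra.
  have nwr : cmod (- w) < rho by rewrite cmodN.
  have w0 : w != 0 by rewrite -cmod_gt0 w34 mulr_gt0 ?divr_gt0.
  have nw0 : - w != 0 by rewrite oppr_eq0.
  have out v : cmod v < rho -> cmod v = 3 / 4 * rho -> forall r, r <= rho / 2 ->
      ~ (chart_dom c (kappa v) /\ cmod (c (kappa v) - c p) <= r).
    move=> vr v34 r r2 [_]; have [_ ->] := kappaP vr.
    by rewrite addrC addKr v34 leNgt => /negP; apply; move: rho_gt0; lra.
  have [fw|fw] := eqVneq (f (kappa w)) q; last by exists (kappa w) => //; exact: out.
  exists (kappa (- w)); first by apply: out => //; rewrite cmodN.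
  rewrite -fw; apply/eqP => ff.
  have := kappa_inj nwr wr (f_inj (kappa_neq nwr nw0) (kappa_neq wr w0) ff).
  move=> /eqP; rewrite -subr_eq0 -opprD oppr_eq0 -mulr2n mulrn_eq0 /=.
  by rewrite (negbTE w0).
have [d Nd dq] := atlas_cover q; have dP := atlas_chart Nd.
have [e e0 eV] := chart_disc q dP dq Vq.
have [del [del0 dele y0out]] : exists del, [/\ 0 < del, del < e &
    ~ (chart_dom d (f x0) /\ cmod (d (f x0) - d q) < del)].
  have [dy|ndy] := pselect (chart_dom d (f x0)); last first.
    exists (e / 2); split => //; first by rewrite divr_gt0.
      by rewrite ltr_pdivrMr // ltr_pMr // ltr1n.
    by case.
  have y0q : 0 < cmod (d (f x0) - d q).
    rewrite cmod_gt0 subr_eq0; apply: contra_neq fx0 => dd.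
    by have [_ inj _ _] := dP; apply: inj; rewrite ?inE.
  exists (Num.min (e / 2) (cmod (d (f x0) - d q))); split.
  - by rewrite lt_min y0q divr_gt0.
  - by rewrite gt_min ltr_pdivrMr // ltr_pMr // ltr1n.
  - by move=> [_]; rewrite lt_min ltxx andbF.
pose B := [set y | chart_dom d y /\ cmod (d y - d q) < del].
pose Bc := [set y | chart_dom d y /\ cmod (d y - d q) <= del].
have dele_img z : cmod (z - d q) <= del -> (d @` chart_dom d) z.
  by move=> zd; have [] := eV z (le_lt_trans zd dele).
have oB : open B by exact: open_chart_disc.
have cB : closed Bc by exact: closed_chart_disc.
have Bq : B q by split => //; rewrite subrr cmod0.
have BV y : B y -> V y.
  move=> [dy yd]; have [_] := eV (d y) (lt_trans yd dele).
  by rewrite chart_invK.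
have rho2 : 0 < rho / 2 by rewrite divr_gt0.
have [r [r0 r2 rr Cr]] := circles B (open_nbhs_nbhs (conj oB Bq)) _ rho2.
pose ext := ~` [set x | chart_dom c x /\ cmod (c x - c p) <= r].
pose extc := ~` [set x | chart_dom c x /\ cmod (c x - c p) < r].
have ext_p x : ext x -> x != p.
  move=> ex; apply/eqP => xp; apply: ex; rewrite xp /=.
  by rewrite subrr cmod0 ltW.
have extc_p x : extc x -> x != p.
  move=> ex; apply/eqP => xp; apply: ex; rewrite xp /=.
  by rewrite subrr cmod0.
have ext_extc : ext `<=` extc by move=> x ex [cx xr]; apply: ex; rewrite /= ltW.
have extcE x : extc x -> ext x \/ B (f x).
  move=> ex; have [ext_x|/contrapT [cx xr]] := pselect (ext x); first by left.
  right; apply: Cr => //; apply/eqP; rewrite eq_le xr leNgt.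
  by apply/negP => xr'; exact: ex.
have o_ext : open ext.
  apply/closed_openC/closed_chart_disc => // z zr; apply: rho_disc.
  exact: le_lt_trans rr.
have c_extc : closed extc by apply/open_closedC/open_chart_disc.
have oV : open (f @` ext).
  rewrite openE => _ [x ex <-]; have xp := ext_p x ex.
  have h1 : \forall y \near f x, ext (g y).
    by apply: (g_cont (fU xp)); rewrite fK //; exact: open_nbhs_nbhs.
  have h2 : \forall y \near f x, U y by apply: open_nbhs_nbhs; split => //; exact: fU.
  by apply: filterS2 h1 h2 => y gy Uy; exists (g y) => //; exact: gK.
have cV : closed (f @` extc).
  apply: compact_closed; first exact: rs_hausdorff.
  apply: continuous_compact; last first.
    by apply: subclosed_compact c_extc M_compact _.
  apply: continuous_in_subspaceT => x; rewrite inE => /extc_p xp.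
  by have [] := f_holo xp.
have clopen (A : set N) : A !=set0 -> open A -> closed A -> A = setT.
  move=> A0 oA cA; apply: N_connected => //.
    by exists A => //; rewrite setTI.
  by exists A => //; rewrite setTI.
pose S := [set y | chart_dom d y /\ cmod (d y - d q) = del].
have SB y : S y -> ~ B y by move=> [_ yd] [_]; rewrite yd ltxx.
have BcE y : Bc y -> B y \/ S y.
  move=> [dy]; rewrite le_eqVlt => /orP[/eqP yd|yd]; first by right.
  by left.
have S_conn : connected S.
  pose u t := chart_inv d q (d q + cexp (ln del +i* t)).
  have delE : expR (ln del) = del by rewrite lnK.
  have ud t : (d @` chart_dom d) (d q + cexp (ln del +i* t)).
    by apply: dele_img; rewrite addrC addKr cmod_cexp delE.
  have -> : S = u @` setT.
    rewrite eqEsubset; split=> [y [dy yd]|_ [t _ <-]].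
      have [|t _ te] := @cexp_polar _ (d y - d q) (ln del); first by rewrite delE.
      by exists t => //; rewrite /u -te addrC subrK chart_invK.
    have [du eu] := chart_invP q (ud t); split => //.
    by rewrite eu addrC addKr cmod_cexp delE.
  apply: connected_continuous_connected.
    by apply/connected_intervalP.
  apply: continuous_subspaceT => t.
  have h1 : (fun t => d q + cexp (ln del +i* t)) @ t --> d q + cexp (ln del +i* t).
    exact: (cvgCD (cvg_cst _) (@cexp_line_continuous _ _ t)).
  exact: (cvg_comp _ _ h1 (@chart_inv_continuous _ _ d q dP _ (ud t))).
exists r; first by rewrite r0 ltW.
move=> y ny; apply: BV; apply: contrapT => nBy.
have [[s [Ss Vs]]|SV] := pselect (exists s, S s /\ (f @` ext) s).
  have SV : S `<=` f @` ext.
    have <- : S `&` (f @` ext) = S.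
      apply: S_conn; first by exists s.
        by exists (f @` ext).
      exists (f @` extc) => //; rewrite eqEsubset; split=> y' [Sy [x ex xy]].
        by split => //; exists x => //; exact: ext_extc.
      split => //; have [ex'|Bx] := extcE x ex; first by exists x.
      by case: (SB y' Sy); rewrite -xy.
    by move=> y' [].
  have all : (f @` ext) `|` B = setT.
    apply: clopen; first by exists q; right.
      exact: openU.
    rewrite (_ : _ `|` _ = (f @` extc) `|` Bc); first exact: closedU.
    rewrite eqEsubset; split=> y' [].
    - by move=> [x ex xy]; left; exists x => //; exact: ext_extc.
    - by move=> [dy yd]; right; split => //; exact: ltW.
    - move=> [x ex xy]; have [ex'|Bx] := extcE x ex; first by left; exists x.
      by right; rewrite -xy.
    - by move=> /BcE[By|/SV Vy]; [right|left].
  have : ((f @` ext) `|` B) y by rewrite all.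
  by case=> [[x ex xy]|//]; apply: ny; exists x.
have all : (f @` ext) `&` ~` Bc = setT.
  apply: clopen.
  - exists (f x0); split; first by exists x0 => //; apply: x0out; exact: ltW.
    move=> /BcE[//|Sx]; apply: SV; exists (f x0); split => //.
    by exists x0 => //; apply: x0out; exact: ltW.
  - by apply: openI => //; exact: closed_openC.
  - rewrite (_ : _ `&` _ = (f @` extc) `&` ~` B).
      by apply: closedI => //; exact: open_closedC.
    rewrite eqEsubset; split=> y' [[x ex xy] nB].
      split; first by exists x => //; exact: ext_extc.
      by move=> [dy yd]; apply: nB; split => //; exact: ltW.
    have ex' : ext x.
      by have [//|Bx] := extcE x ex; case: nB; rewrite -xy.
    split; first by exists x.
    move=> /BcE[//|Sy]; apply: SV; exists y'; split => //; by exists x.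
have : ((f @` ext) `&` ~` Bc) q by rewrite all.
by move=> [_]; apply; split => //; rewrite subrr cmod0 ltW.
Qed.

(** By complement_exterior, every neighborhood of q contains both the points
    outside U and the image of a punctured disc. That q is not in U follows from the
    continuity of g, since f(x) tends to q as x tends to p. *)
Lemma puncture_limit : exists q : N, [/\ ~ U q, forall y, y != q -> U y &
  forall V, nbhs q V -> \forall x \near p, x != p -> V (f x)].
Proof.
have [q circles] := puncture_circles; exists q.
have near_p V : nbhs q V -> \forall x \near p, x != p -> V (f x).
  move=> Vq; have [r /andP[r0 rr] rV] := complement_exterior Vq circles.
  pose Dr := [set x | chart_dom c x /\ cmod (c x - c p) < r].
  have pr : Dr p by split => //; rewrite subrr cmod0.
  have oD : open Dr by exact: open_chart_disc.
  apply: filterS (open_nbhs_nbhs (conj oD pr)) => x [cx xr] xp.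
  apply: rV => -[x' ex' ff]; have x'p : x' != p.
    apply: contra_not_neq ex' => ->.
    by rewrite subrr cmod0 ltW.
  by apply: ex'; rewrite (f_inj x'p xp ff); split => //; exact: ltW.
split=> //.
- move=> Uq; have gq := gp Uq; move/eqP: (gq); apply; apply/esym.
  apply: (@rs_hausdorff _ M) => A B Ap Bg.
  have hB : nbhs q (g @^-1` B) by exact: (g_cont Uq).
  have near_AB : \forall x \near p, A x /\ (x != p -> B (g (f x))).
    exact: filterI Ap (near_p _ hB).
  have [e e0 eA] := chart_disc p cP cp near_AB.
  pose w : Cplane R := (Num.min (e / 2) (rho / 2))%:C.
  have w0 : 0 < Num.min (e / 2) (rho / 2) by rewrite lt_min !divr_gt0.
  have we : Num.min (e / 2) (rho / 2) <= e / 2 by rewrite ge_min lexx.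
  have wr : Num.min (e / 2) (rho / 2) <= rho / 2 by rewrite ge_min lexx orbT.
  have cw : cmod w = Num.min (e / 2) (rho / 2) by rewrite cmodR gtr0_norm.
  have wp : kappa w != p by apply: kappa_neq; rewrite -?cmod_gt0 cw //; lra.
  have [|_ [Aw Bw]] := eA (c p + w); first by rewrite addrC addKr cw; lra.
  exists (kappa w); split => //.
  by have := Bw wp; rewrite fK.
- move=> y yq; apply: contrapT => nUy; move/eqP: yq; apply; apply/esym.
  apply: (@rs_hausdorff _ N) => A B Aq By; exists y; split; last exact: nbhs_singleton.
  have [r /andP[r0 rr] rA] := complement_exterior Aq circles.
  apply: rA => -[x ex fx]; apply: nUy; rewrite -fx; apply: fU.
  apply/eqP => xp; apply: ex; rewrite xp.
  by rewrite subrr cmod0 ltW.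
Qed.

End Puncture.

(** * The extension *)

Lemma compact_inverse_continuous {S T : topologicalType} (F : S -> T) (G : T -> S) :
  compact [set: S] -> hausdorff_space T -> continuous F ->
  cancel F G -> cancel G F -> continuous G.
Proof.
move=> cS hT cF FK GK; apply/continuous_closedP => A cA.
rewrite (_ : G @^-1` A = F @` A).
  apply: compact_closed => //; apply: continuous_compact.
    exact: continuous_subspaceT.
  exact: subclosed_compact cA cS _.
rewrite eqEsubset; split=> [y Ay|_ [x Ax <-]]; last by rewrite /preimage /= FK.
by exists (G y).
Qed.

Lemma punctured_disc {R : realType} (M : riemannSurface R) (p : M) :
  exists c rho, [/\ atlas M c, chart_dom c p, 0 < rho,
    forall z, cmod (z - c p) < rho -> (c @` chart_dom c) z &
    exists x, x != p].
Proof.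
have [c Mc cp] := atlas_cover p; have cP := atlas_chart Mc.
have [e e0 ez] := chart_disc p cP cp filterT.
exists c, e; split => //; first by move=> z /ez[].
pose w : Cplane R := ((e / 2)%:C)%C; pose z : Cplane R := c p + w.
have we : cmod w = e / 2 by rewrite cmodR gtr0_norm // divr_gt0.
have [cz _] : (c @` chart_dom c) z /\ True.
  apply: ez; rewrite /z addrC addKr we; lra.
exists (chart_inv c p z); have [_] := chart_invP p cz.
apply: contra_eq_neq => ->; rewrite /z.
rewrite -subr_eq0 opprD addNKr oppr_eq0 -cmod_gt0 we divr_gt0 //.
Qed.

Theorem theorem1 (R : realType) (M N : riemannSurface R)
    (M_compact : compact [set: M]) (M_connected : connected [set: M])
    (p : M)
    (N_compact : compact [set: N]) (N_connected : connected [set: N])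
    (U : set N) (U_open : open U)
    (phi : punctured p -> open_surface U_open)
    (phi_iso : biholomorphism phi) :
  exists Phi : M -> N,
    biholomorphism Phi /\
    (forall x : punctured p, Phi (set_val x) = set_val (phi x)).
Proof.
have [phi_holo [psi [psi_holo phiK psiK]]] := phi_iso.
have [c [rho [Mc cp rho0 rhoP [x1 x1p]]]] := punctured_disc p.
pose pt x (xp : x != p) : punctured p :=
  exist _ x (mem_set (elimN eqP xp : (~` [set p]) x)).
have pt_val x (xp : x != p) : set_val (pt x xp) = x by [].
have val_p (u : punctured p) : set_val u != p.
  by apply/eqP; exact: (set_valP u).
pose ptU y (Uy : U y) : open_surface U_open := exist _ y (mem_set Uy).
have val_U (v : open_surface U_open) : U (set_val v) := set_valP v.
(* extensions of phi and of its inverse by arbitrary values *)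
have /choice[f fP] : forall x : M, exists y : N, forall u : punctured p,
    set_val u = x -> y = set_val (phi u).
  move=> x; have [xp|xp] := pselect (x != p).
    by exists (set_val (phi (pt x xp))) => u ux; congr (set_val (phi _)); apply: val_inj.
  exists (set_val (phi (pt x1 x1p))) => u ux.
  by case: xp; rewrite -ux val_p.
have /choice[g gP] : forall y : N, exists x : M, forall v : open_surface U_open,
    set_val v = y -> x = set_val (psi v).
  move=> y; have [Uy|Uy] := pselect (U y).
    by exists (set_val (psi (ptU y Uy))) => v vy; congr (set_val (psi _)); apply: val_inj.
  by exists p => v vy; case: Uy; rewrite -vy.
have fE (u : punctured p) : f (set_val u) = set_val (phi u) by apply: fP.
have gE (v : open_surface U_open) : g (set_val v) = set_val (psi v) by apply: gP.
have fU x : x != p -> U (f x) by move=> xp; rewrite -(pt_val x xp) fE.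
have fK x : x != p -> g (f x) = x.
  by move=> xp; rewrite -{1}(pt_val x xp) fE gE phiK.
have gp y : U y -> g y != p by move=> Uy; rewrite -[y]/(set_val (ptU y Uy)) gE.
have gK y : U y -> f (g y) = y.
  by move=> Uy; rewrite -{1}[y]/(set_val (ptU y Uy)) gE fE psiK.
have f_holo x : x != p -> holomorphic_at f x.
  by move=> /eqP xp; exact: (holomorphic_at_open phi_holo fE xp).
have g_holo y : U y -> holomorphic_at g y.
  by move=> Uy; exact: (holomorphic_at_open psi_holo gE Uy).
have g_cont y : U y -> g @ y --> g y by move=> /g_holo[].
have [q [nUq qU q_lim]] := @puncture_limit _ _ _ M_compact N_compact N_connected
  p U f g U_open fU fK gp gK f_holo g_cont c rho Mc cp rho0 rhoP.
pose F x := if x == p then q else f x.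
pose G y := if y == q then p else g y.
have Fp : F p = q by rewrite /F eqxx.
have Gq : G q = p by rewrite /G eqxx.
have Fx x : x != p -> F x = f x by rewrite /F => /negbTE ->.
have Gy y : U y -> G y = g y.
  by move=> Uy; rewrite /G; case: eqVneq => // yq; case: nUq; rewrite -yq.
have FE (u : punctured p) : F (set_val u) = set_val (phi u) by rewrite Fx.
have GE (v : open_surface U_open) : G (set_val v) = set_val (psi v) by rewrite Gy.
have FK : cancel F G.
  move=> x; have [->|xp] := eqVneq x p; first by rewrite Fp Gq.
  by rewrite Fx // Gy ?fK //; exact: fU.
have GK : cancel G F.
  move=> y; have [->|/qU Uy] := eqVneq y q; first by rewrite Gq Fp.
  by rewrite Gy // Fx ?gK //; exact: gp.
have F_holo x : x != p -> holomorphic_at F x.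
  by move=> /eqP xp; exact: (holomorphic_at_open phi_holo FE xp).
have G_holo y : y != q -> holomorphic_at G y.
  by move=> /qU Uy; exact: (holomorphic_at_open psi_holo GE Uy).
have F_cont : continuous F.
  move=> x; have [->|/F_holo[]//] := eqVneq x p.
  move=> V; rewrite Fp => Vq.
  suff FV : \forall x \near p, V (F x) by exact: FV.
  apply: filterS (q_lim V Vq) => u; have [->|up Vu] := eqVneq u p.
    by rewrite Fp => _; exact: (nbhs_singleton Vq).
  by rewrite Fx //; exact: Vu.
have G_cont : continuous G.
  exact: (compact_inverse_continuous M_compact (@rs_hausdorff _ N) F_cont FK GK).
exists F; split => //; split.
  apply: holomorphic_at_holomorphic => x; have [->|/F_holo//] := eqVneq x p.
  exact: (removable_holomorphic_at (F_cont p) F_holo).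
exists G; split => //; apply: holomorphic_at_holomorphic => y.
have [->|/G_holo//] := eqVneq y q.
exact: (removable_holomorphic_at (G_cont q) G_holo).
Qed.
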